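(* Let $f\in L^2(\mathbf{T})$ with $\int_{\mathbf{T}} f(x)\,dx=0$ and Fourier expansion $f(x)\sim\sum_{\ell\in\mathbf{Z}} a_\ell e^{2\pi i \ell x}$, $a_0=0$. Define $g(r)=\sum_{k=1}^\infty |a_{rk}|^2$, $G(r)=\sum_{j\le 2r} g(j)$, and $h(n)=\sum_{d\mid n}\big(d\,g(d)+G(d)\big)$. Then $\sum_{k=1}^\infty c_k f(kx)$ converges for almost every $x$ provided $\sum_{k=1}^\infty c_k^2 h(k)(\log k)^2<\infty$. On the other hand, for any $\delta>0$ there exist a function $f\in L^2(\mathbf{T})$ with $\int_{\mathbf{T}} f(x)\,dx=0$ and Fourier coefficient $a_0=0$, and real coefficients $c_k$, such that, with $h$ computed from the Fourier coefficients of this $f$ by the formulas $g(r)=\sum_{k\ge1}|a_{rk}|^2$, $G(r)=\sum_{j\le 2r}g(j)$, $h(n)=\sum_{d\mid n}(d\,g(d)+G(d))$, one has $\sum_{k=1}^\infty c_k^2 h(k)(\log k)^{-\delta}<\infty$, but $\sum_{k=1}^\infty c_k f(kx)$ does not converge almost everywhere.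
   Context: $\mathbf{T}=\mathbf{R}/\mathbf{Z}\simeq[0,1)$ with Lebesgue measure. The coefficients $c_k$ are real.
   Formalization: The function f is taken real-valued (for complex f the first claim fails, e.g. f(x)=e^{-2πix}, c_k=1, where g and h vanish but the series diverges), and the undefined k=1 factor (log 1)^{-δ} in the second part is read as 0. *)

(* Defs.v *)
From HB Require Import structures.
From mathcomp Require Import all_boot all_order all_algebra.
From mathcomp Require Import all_classical all_reals all_analysis.
Set Implicit Arguments. Unset Strict Implicit. Unset Printing Implicit Defensive.
Import Order.TTheory GRing.Theory Num.Theory.
Import numFieldNormedType.Exports.
Local Open Scope classical_set_scope.
Local Open Scope ring_scope.

(* T = R/Z is represented by [0,1) with Lebesgue measure; functions on T are
   1-periodic real functions on R. *)

Definition mu {R : realType} := @lebesgue_measure R.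

(* real and imaginary parts (up to sign) of the l-th Fourier coefficient
   a_l = \int_0^1 f(x) e^{-2 pi i l x} dx  of a real function f *)
Definition fcos {R : realType} (f : R -> R) (l : nat) : R :=
  Rintegral mu `[0, 1[ (fun x => f x * cos (2 * pi * l%:R * x)).
Definition fsin {R : realType} (f : R -> R) (l : nat) : R :=
  Rintegral mu `[0, 1[ (fun x => f x * sin (2 * pi * l%:R * x)).

Definition asq {R : realType} (f : R -> R) (l : nat) : R :=
  fcos f l ^+ 2 + fsin f l ^+ 2.

Definition gfun {R : realType} (f : R -> R) (r : nat) : R :=
  limn (fun n => \sum_(1 <= k < n) asq f (r * k)%N).

Definition Gfun {R : realType} (f : R -> R) (r : nat) : R :=
  \sum_(1 <= j < (2 * r).+1) gfun f j.

Definition hfun {R : realType} (f : R -> R) (n : nat) : R :=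
  \sum_(d <- divisors n) (d%:R * gfun f d + Gfun f d).

Definition L2T0 {R : realType} (f : R -> R) : Prop :=
  measurable_fun setT f /\
  (forall x, f (x + 1) = f x) /\
  (\int[mu]_(x in `[0%R, 1%R[) ((f x) ^+ 2)%:E < +oo)%E /\
  Rintegral mu `[0, 1[ f = 0.

Definition dilsum {R : realType} (f : R -> R) (c : nat -> R) (x : R) (N : nat) : R :=
  \sum_(1 <= k < N.+1) c k * f (k%:R * x).

Definition ae_conv {R : realType} (f : R -> R) (c : nat -> R) : Prop :=
  {ae mu, forall x : R, `[0%R, 1%R[%classic x -> cvgn (dilsum f c x)}.

(* Main.v *)
(* Convergence.  Partial Fourier sums of f tend to f in L^2 (Fejer means are
   trigonometric polynomials, uniformly bounded and pointwise convergent for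
   continuous functions, and continuous functions are dense) and x |-> k x
   preserves the integrals of periodic functions, so block estimates may be
   proved for trigonometric polynomials.  There the frequencies k l and j l' of
   f(k x) and f(j x) interact only when k l = j l', that is l is a multiple of
   j / gcd(j, k).  Applying |ab| <= (a^2 + b^2) / 2 to each interaction bounds
   the square norm of \sum_(k in I) c_k f(k x) by a multiple of
   \sum_k c_k^2 \sum_(j in I) g(j / gcd(j, k)); when I lies in some [p, 2p] the
   pair (d, i) = (k / gcd, j / gcd) satisfies d | k and i <= 2d, and the inner
   sum is at most \sum_(d | k) G(d) <= h(k).  The Rademacher-Menshov dyadic
   argument on the blocks [2^m, 2^(m+1)[ then costs the factor (log k)^2.

   Divergence.  For f(x) = cos(2 pi x), h is constant on the primes.  Take
   c_k = 1 on a very sparse set of primes and 0 elsewhere: the weighted series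
   converges, but cos(2 pi p x) does not tend to 0 almost everywhere along these
   primes since its square has integral 1/2. *)

Require Import Defs.
From HB Require Import structures.
From mathcomp Require Import all_boot all_order all_algebra.
From mathcomp Require Import all_classical all_reals all_analysis.
From mathcomp Require Import measurable_realfun.
From mathcomp Require Import ring lra zify.
Import Order.TTheory GRing.Theory Num.Theory.
Import numFieldNormedType.Exports.
Local Open Scope classical_set_scope.
Local Open Scope ring_scope.

(** * Square-integrable functions on the unit interval *)

Section SquareIntegrable.
Context {R : realType}.
Implicit Types f g h : R -> R.

Local Notation D := (`[0%R, 1%R[%classic : set R).
Local Notation mu := (@lebesgue_measure R).

Definition sqint f := measurable_fun D f /\
  mu.-integrable D (EFin \o (fun x => f x ^+ 2)).

Definition ip f g : R := Rintegral mu D (fun x => f x * g x).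

Lemma integrable_unitD f g : mu.-integrable D (EFin \o f) ->
  mu.-integrable D (EFin \o g) -> mu.-integrable D (EFin \o (fun x => f x + g x)).
Proof.
by move=> fi gi; apply: eq_integrable (integrableD _ fi gi) => //.
Qed.

Lemma integrable_unitZ k f : mu.-integrable D (EFin \o f) ->
  mu.-integrable D (EFin \o (fun x => k * f x)).
Proof.
by move=> fi; apply: eq_integrable (integrableZl _ k fi) => //.
Qed.

(** The product is dominated pointwise, since [|f g| <= f^2 + g^2]. *)
Lemma sqintM f g : sqint f -> sqint g ->
  mu.-integrable D (EFin \o (fun x => f x * g x)).
Proof.
move=> [mf f2] [mg g2].
apply: (@le_integrable _ _ _ mu D _ _
   (EFin \o (fun x => f x ^+ 2 + g x ^+ 2))) => //.
- by apply/measurable_EFinP; exact: measurable_funM.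
- move=> x _ /=; rewrite lee_fin [leRHS]ger0_norm ?addr_ge0 ?sqr_ge0//.
  by rewrite ler_norml; apply/andP; split; nra.
- exact: integrable_unitD.
Qed.

Lemma sqint_bounded f (M : R) : measurable_fun D f ->
  (forall x, D x -> `|f x| <= M) -> sqint f.
Proof.
move=> mf fM; split=> //.
apply: measurable_bounded_integrable => //.
- by rewrite /= lebesgue_measure_itv/= lte_fin ltr01 ltry.
- exact: measurable_funX.
- exists (M ^+ 2); split; first exact: num_real.
  move=> y My x Dx; rewrite /= normrX (le_trans _ (ltW My))// lerXn2r// ?nnegrE//.
    by rewrite (le_trans _ (fM x Dx)).
  exact: fM.
Qed.

Lemma sqintD f g : sqint f -> sqint g -> sqint (fun x => f x + g x).
Proof.
move=> [mf f2] [mg g2]; split; first exact: measurable_funD.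
apply: (@le_integrable _ _ _ mu D _ _
   (EFin \o (fun x => 2 * f x ^+ 2 + 2 * g x ^+ 2))) => //.
- by apply/measurable_EFinP; apply: measurable_funX; exact: measurable_funD.
- move=> x _ /=; rewrite lee_fin [leLHS]ger0_norm ?sqr_ge0//.
  rewrite [leRHS]ger0_norm; last by rewrite addr_ge0// mulr_ge0// sqr_ge0.
  by have := sqr_ge0 (f x - g x); lra.
- apply: (@integrable_unitD (fun x => 2 * f x ^+ 2) (fun x => 2 * g x ^+ 2)).
    exact: (@integrable_unitZ 2 (fun x => f x ^+ 2)).
  exact: (@integrable_unitZ 2 (fun x => g x ^+ 2)).
Qed.

Lemma sqintZ (k : R) f : sqint f -> sqint (fun x => k * f x).
Proof.
move=> [mf f2]; split; first exact: measurable_funM.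
rewrite (_ : (fun x => _) = fun x => k ^+ 2 * f x ^+ 2).
  exact: (@integrable_unitZ (k ^+ 2) (fun x => f x ^+ 2)).
by apply/funext => x; rewrite exprMn.
Qed.

Lemma sqint_cst (k : R) : sqint (fun=> k).
Proof. by apply: (@sqint_bounded _ `|k|). Qed.

Lemma sqintB f g : sqint f -> sqint g -> sqint (fun x => f x - g x).
Proof.
move=> sf /(sqintZ (-1)) sg; rewrite (_ : (fun x => _) = fun x => f x + -1 * g x).
  exact: sqintD.
by apply/funext => x; rewrite mulN1r.
Qed.

Lemma sqint_sum (I : Type) (s : seq I) (P : pred I) (F : I -> R -> R) :
  (forall i, P i -> sqint (F i)) -> sqint (fun x => \sum_(i <- s | P i) F i x).
Proof.
move=> sF; elim: s => [|i s IH].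
  by under eq_fun do rewrite big_nil; exact: sqint_cst.
under eq_fun do rewrite big_cons.
case Pi: (P i); last exact: IH.
by apply: sqintD => //; exact: sF.
Qed.

Lemma ipC f g : ip f g = ip g f.
Proof. by rewrite /ip; under eq_Rintegral do rewrite mulrC. Qed.

Lemma eq_ip f1 f2 g1 g2 : (forall x, D x -> f1 x = f2 x) ->
  (forall x, D x -> g1 x = g2 x) -> ip f1 g1 = ip f2 g2.
Proof. by move=> ff gg; apply: eq_Rintegral => x /[!inE] Dx; rewrite ff ?gg. Qed.

Lemma ipDl f g h : sqint f -> sqint g -> sqint h ->
  ip (fun x => f x + g x) h = ip f h + ip g h.
Proof.
move=> sf sg sh; rewrite /ip; under eq_Rintegral do rewrite mulrDl.
by rewrite RintegralD//; exact: sqintM.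
Qed.

Lemma ipZl k f g : sqint f -> sqint g -> ip (fun x => k * f x) g = k * ip f g.
Proof.
move=> sf sg; rewrite /ip; under eq_Rintegral do rewrite -mulrA.
by rewrite RintegralZl//; exact: sqintM.
Qed.

Lemma ipBl f g h : sqint f -> sqint g -> sqint h ->
  ip (fun x => f x - g x) h = ip f h - ip g h.
Proof.
move=> sf sg sh; rewrite /ip; under eq_Rintegral do rewrite mulrBl.
by rewrite RintegralB//; exact: sqintM.
Qed.

Lemma ip_suml (I : Type) (s : seq I) (P : pred I) (F : I -> R -> R) g :
  (forall i, P i -> sqint (F i)) -> sqint g ->
  ip (fun x => \sum_(i <- s | P i) F i x) g = \sum_(i <- s | P i) ip (F i) g.
Proof.
move=> sF sg; elim: s => [|i s IH].
  rewrite big_nil /ip; under eq_Rintegral do rewrite big_nil mul0r.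
  by rewrite Rintegral_cst ?mul0r//.
rewrite big_cons -IH; case Pi: (P i).
  rewrite -ipDl//; [|exact: sF|exact: sqint_sum].
  by apply: eq_ip => // x _; rewrite big_cons Pi.
by apply: eq_ip => // x _; rewrite big_cons Pi.
Qed.

Lemma ipDr f g h : sqint f -> sqint g -> sqint h ->
  ip h (fun x => f x + g x) = ip h f + ip h g.
Proof. by move=> *; rewrite ipC ipDl// !(ipC h). Qed.

Lemma ipZr k f g : sqint f -> sqint g -> ip g (fun x => k * f x) = k * ip g f.
Proof. by move=> *; rewrite ipC ipZl// ipC. Qed.

Lemma ipBr f g h : sqint f -> sqint g -> sqint h ->
  ip h (fun x => f x - g x) = ip h f - ip h g.
Proof. by move=> *; rewrite ipC ipBl// !(ipC h). Qed.

Lemma ip_sumr (I : Type) (s : seq I) (P : pred I) (F : I -> R -> R) g :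
  (forall i, P i -> sqint (F i)) -> sqint g ->
  ip g (fun x => \sum_(i <- s | P i) F i x) = \sum_(i <- s | P i) ip g (F i).
Proof. by move=> *; rewrite ipC ip_suml//; under eq_bigr do rewrite ipC. Qed.

Lemma ip_ge0 f : 0 <= ip f f.
Proof. by apply: Rintegral_ge0 => x _; rewrite -expr2 sqr_ge0. Qed.

Lemma integral_sqE f : sqint f ->
  (\int[mu]_(x in D) ((f x) ^+ 2)%:E)%E = (ip f f)%:E.
Proof.
move=> sf; rewrite /ip /Rintegral fineK.
  by apply: eq_integral => x _; rewrite expr2.
by apply: integrable_fin_num => //; exact: sqintM.
Qed.

(** The parallelogram law with the square norm of [f - g] dropped. It stands in for the triangle
    inequality, so that all estimates can be made on squared norms. *)
Lemma ip_sqD f g : sqint f -> sqint g ->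
  ip (fun x => f x + g x) (fun x => f x + g x) <= 2 * ip f f + 2 * ip g g.
Proof.
move=> sf sg; have sfg := sqintD _ _ sf sg.
have sB := sqintB _ _ sf sg; have := ip_ge0 (fun x => f x - g x).
rewrite ipBl// !ipBr// ipDl// !ipDr// (ipC g f); lra.
Qed.

End SquareIntegrable.

(** * The trigonometric system *)

Section Trigonometric.
Context {R : realType}.
Implicit Types (f g h : R -> R) (x y t : R) (l m n a b : nat).

Local Notation D := (`[0%R, 1%R[%classic : set R).
Local Notation mu := (@lebesgue_measure R).

Definition cs l x : R := cos (2 * pi * l%:R * x).
Definition sn l x : R := sin (2 * pi * l%:R * x).

Lemma continuous_cs l : continuous (cs l).
Proof.
move=> x; apply: (@continuous_comp _ _ _ (fun x => 2 * pi * l%:R * x) cos).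
  by apply: cvgM; [exact: cvg_cst|exact: cvg_id].
exact: continuous_cos.
Qed.

Lemma continuous_sn l : continuous (sn l).
Proof.
move=> x; apply: (@continuous_comp _ _ _ (fun x => 2 * pi * l%:R * x) sin).
  by apply: cvgM; [exact: cvg_cst|exact: cvg_id].
exact: continuous_sin.
Qed.

Lemma sqint_continuous_bounded f (M : R) : continuous f ->
  (forall x, `|f x| <= M) -> sqint f.
Proof.
move=> cf fM; apply: (@sqint_bounded _ _ M) => //.
by apply: measurable_funTS; exact: continuous_measurable_fun.
Qed.

Lemma sqint_cs l : sqint (cs l).
Proof.
by apply: (@sqint_continuous_bounded _ 1) => [|x]; [exact: continuous_cs|exact: cos_max].
Qed.

Lemma sqint_sn l : sqint (sn l).
Proof.
by apply: (@sqint_continuous_bounded _ 1) => [|x]; [exact: continuous_sn|exact: sin_max].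
Qed.

Lemma cs0 x : cs 0 x = 1.
Proof. by rewrite /cs mulr0 mul0r cos0. Qed.

Lemma sn0 x : sn 0 x = 0.
Proof. by rewrite /sn mulr0 mul0r sin0. Qed.

Lemma csB l x y : cs l (x - y) = cs l x * cs l y + sn l x * sn l y.
Proof. by rewrite /cs mulrBr cosB. Qed.

Lemma snB l x y : sn l (x - y) = sn l x * cs l y - cs l x * sn l y.
Proof. by rewrite /sn mulrBr sinB. Qed.

Lemma cs_at1 l : cs l 1 = 1.
Proof.
rewrite /cs mulr1 (_ : 2 * pi * l%:R = 0 + (pi *+ 2) *+ l).
  by rewrite (periodicn (@cosD2pi R)) cos0.
by rewrite add0r mulr_natr mulr_natl.
Qed.

Lemma sn_at1 l : sn l 1 = 0.
Proof.
rewrite /sn mulr1 (_ : 2 * pi * l%:R = 0 + (pi *+ 2) *+ l).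
  by rewrite (periodicn (@sinD2pi R)) sin0.
by rewrite add0r mulr_natr mulr_natl.
Qed.

Lemma Rintegral_derivative (F f : R -> R) : continuous f ->
  (forall x, is_derive x 1 F (f x)) -> Rintegral mu D f = F 1 - F 0.
Proof.
move=> cf dF.
have cF : continuous F.
  by move=> x; apply/differentiable_continuous/derivable1_diffP; exact: ex_derive.
have if01 : mu.-integrable `[0%R, 1%R] (EFin \o f).
  apply: continuous_compact_integrable; first exact: segment_compact.
  exact: continuous_subspaceT.
rewrite Rintegral_itv_bndo_bndc; last first.
  by apply: integrableS if01 => //; exact: subset_itv_co_cc.
rewrite /Rintegral (@continuous_FTC2 _ f F 0 1)//.
- exact: continuous_subspaceT.
- split.
  + by move=> x _; exact: ex_derive.
  + by apply: cvg_at_right_filter; exact: cF.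
  + by apply: cvg_at_left_filter; exact: cF.
- by move=> x _; rewrite derive1E; exact: derive_val.
Qed.

Lemma Rintegral_cs l : Rintegral mu D (cs l) = (l == 0%N)%:R.
Proof.
have [->|l0] := eqVneq l 0%N.
  rewrite (_ : cs 0 = fun=> 1); last by apply/funext => x; exact: cs0.
  by rewrite Rintegral_cst// mul1r /= lebesgue_measure_itv/= lte_fin ltr01 oppr0 addr0.
have k0 : 2 * pi * l%:R != 0 :> R.
  by rewrite !mulf_neq0// ?pnatr_eq0// gt_eqF// pi_gt0.
have dF x : is_derive x 1 (fun x => (2 * pi * l%:R)^-1 * sn l x) (cs l x).
  rewrite /sn /cs; apply: is_derive_eq.
  by rewrite /GRing.scale/= mulr1 mulrCA mulVf// mulr1.
rewrite (Rintegral_derivative _ _ (@continuous_cs l) dF).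
by rewrite sn_at1 /sn !mulr0 sin0 mulr0 subrr.
Qed.

Lemma Rintegral_sn l : Rintegral mu D (sn l) = 0.
Proof.
have [->|l0] := eqVneq l 0%N.
  rewrite (_ : sn 0 = fun=> 0); last by apply/funext => x; exact: sn0.
  by rewrite Rintegral_cst// mul0r.
have k0 : 2 * pi * l%:R != 0 :> R.
  by rewrite !mulf_neq0// ?pnatr_eq0// gt_eqF// pi_gt0.
have dF x : is_derive x 1 (fun x => - (2 * pi * l%:R)^-1 * cs l x) (sn l x).
  rewrite /sn /cs; apply: is_derive_eq.
  by rewrite /GRing.scale/= mulr1 mulNr mulNr mulrN opprK mulrCA mulVf// mulr1.
rewrite (Rintegral_derivative _ _ (@continuous_sn l) dF).
by rewrite cs_at1 /cs mulr0 cos0 subrr.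
Qed.

(** The absolute value of [l - m], in truncated subtraction. Cosine being even, this keeps every
    frequency a natural number. *)
Definition distn (l m : nat) : nat := (l - m + (m - l))%N.

Lemma distnn l : distn l l = 0%N. Proof. by rewrite /distn subnn. Qed.

Lemma distn_eq0 l m : (distn l m == 0%N) = (l == m).
Proof. by rewrite /distn; lia. Qed.

Lemma csMcs_snMsn l m x : cs l x * cs m x + sn l x * sn m x = cs (distn l m) x.
Proof.
rewrite /cs /sn -cosB /distn; have [lm|ml] := leP l m.
  rewrite (eqP lm) add0n natrB// -cosN; congr cos; ring.
have /eqP -> := ltnW ml; rewrite addn0 natrB ?(ltnW ml)//; congr cos; ring.
Qed.

Lemma csMcsB_snMsn l m x : cs l x * cs m x - sn l x * sn m x = cs (l + m)%N x.
Proof. by rewrite /cs /sn -cosD natrD; congr cos; ring. Qed.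

Lemma ip_cst1 f : ip f (fun=> 1) = Rintegral mu D f.
Proof. by rewrite /ip; under eq_Rintegral do rewrite mulr1. Qed.

(** Product-to-sum formula. The condition [0 < a] makes [a + b] nonzero and so excludes the constant
    pair [a = b = 0], whose inner product is 1 instead of 1/2. *)
Lemma ip_cs_cs a b : (0 < a)%N -> ip (cs a) (cs b) = (a == b)%:R / 2.
Proof.
move=> a0; rewrite (@eq_ip _ (cs a) (fun x => 1 * cs a x) (cs b) (cs b))//; last first.
  by move=> x _; rewrite mul1r.
have -> : ip (fun x => 1 * cs a x) (cs b) =
  ip (fun x => 2^-1 * (cs (distn a b) x + cs (a + b)%N x)) (fun=> 1).
  apply: eq_Rintegral => x _.
  by rewrite -csMcs_snMsn -csMcsB_snMsn; field.
rewrite ipZl ?ipDl ?ip_cst1 ?Rintegral_cs ?distn_eq0 ?addn_eq0; last first.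
  all: try by [exact: sqint_cs|exact: sqint_cst|apply: sqintD; exact: sqint_cs].
by rewrite (gtn_eqF a0) addr0 mulrC.
Qed.

Lemma ip_sn_sn a b : (0 < a)%N -> ip (sn a) (sn b) = (a == b)%:R / 2.
Proof.
move=> a0.
have -> : ip (sn a) (sn b) =
  ip (fun x => 2^-1 * (cs (distn a b) x - cs (a + b)%N x)) (fun=> 1).
  apply: eq_Rintegral => x _.
  by rewrite -csMcs_snMsn -csMcsB_snMsn; field.
rewrite ipZl ?ipBl ?ip_cst1 ?Rintegral_cs ?distn_eq0 ?addn_eq0; last first.
  all: try by [exact: sqint_cs|exact: sqint_cst|apply: sqintB; exact: sqint_cs].
by rewrite (gtn_eqF a0) subr0 mulrC.
Qed.

Lemma snD l m x : sn (l + m) x = sn l x * cs m x + cs l x * sn m x.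
Proof. by rewrite /cs /sn -sinD natrD; congr sin; ring. Qed.

Lemma snBn l m x : (m <= l)%N ->
  sn (l - m) x = sn l x * cs m x - cs l x * sn m x.
Proof. by move=> ml; rewrite /cs /sn -sinB natrB//; congr sin; ring. Qed.

Lemma ip_cs_sn a b : ip (cs a) (sn b) = 0.
Proof.
(* The difference term is [sn (b - a)] or [- sn (a - b)] according to the order of [a] and [b]; the
   sign [s] absorbs the two cases. *)
have [k [s ->]] : exists k (s : R), ip (cs a) (sn b) =
    ip (fun x => 2^-1 * (sn (a + b)%N x + s * sn k x)) (fun=> 1).
  have [ab|/ltnW ba] := leP a b.
    exists (b - a)%N, 1; apply: eq_Rintegral => x _.
    by rewrite snD snBn//; field.
  exists (a - b)%N, (-1); apply: eq_Rintegral => x _.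
  by rewrite snD snBn//; field.
have ss := @sqint_sn; have s1 := @sqint_cst R 1.
have sZ : sqint (fun x => s * sn k x) by apply: sqintZ.
by rewrite ipZl ?ipDl ?ipZl ?ip_cst1 ?Rintegral_sn ?mulr0 ?addr0 ?mulr0//; exact: sqintD.
Qed.

Lemma fcosE f l : fcos f l = ip f (cs l). Proof. by []. Qed.
Lemma fsinE f l : fsin f l = ip f (sn l). Proof. by []. Qed.

End Trigonometric.

(** * Approximation by continuous functions *)

Section DominatedSquares.
Context {R : realType}.
Implicit Types (f g h G : R -> R) (x y t M k e : R).

Local Notation D := (`[0%R, 1%R[%classic : set R).
Local Notation mu := (@lebesgue_measure R).

Lemma ip_ae_dominated_cvg0 (F : nat -> R -> R) G :
  (forall n, measurable_fun D (F n)) -> mu.-integrable D (EFin \o G) ->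
  (forall n x, D x -> F n x ^+ 2 <= G x) ->
  {ae mu, forall x, D x -> F n x @[n --> \oo] --> 0} ->
  ip (F n) (F n) @[n --> \oo] --> 0.
Proof.
move=> mF iG FG F0.
have mF2 n : measurable_fun D (fun x => (F n x ^+ 2)%:E).
  by apply/measurable_EFinP; exact: measurable_funX.
have F20 : {ae mu, forall x, D x -> (F n x ^+ 2)%:E @[n --> \oo] --> 0%E}.
  have [A [mA A0 FA]] := F0; exists A; split => // x /= nF; apply: FA => /= Fx.
  apply: nF => /Fx {}Fx; apply: cvg_EFin; first by near=> n.
  rewrite (_ : _ \o _ = fun n => F n x * F n x); last by apply/funext => n/=; rewrite expr2.
  by rewrite -(mulr0 0); apply: cvgM.
have FG' : {ae mu, forall x, forall n, D x -> (`|(F n x ^+ 2)%:E| <= (G x)%:E)%E}.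
  by apply: aeW => x n Dx /=; rewrite lee_fin ger0_norm ?sqr_ge0//; exact: FG.
have mc : measurable_fun D (fun=> 0%E : \bar R) by exact: measurable_cst.
have [_ _] := @dominated_convergence _ _ _ mu D (measurable_itv _)
  (fun n x => (F n x ^+ 2)%:E) (fun=> 0%E) (EFin \o G) mF2 mc F20 iG FG'.
rewrite integral0 => /fine_cvg; apply: cvg_trans.
rewrite (_ : _ \o _ = fun n => ip (F n) (F n))//.
Unshelve. all: by end_near. Qed.

(** The endpoint 0 is a null set. Leaving it out matters for Fejer means: the approximating
    continuous functions need not be periodic, so convergence may fail there. *)
Lemma ip_dominated_cvg0 (F : nat -> R -> R) G :
  (forall n, measurable_fun D (F n)) -> mu.-integrable D (EFin \o G) ->
  (forall n x, D x -> F n x ^+ 2 <= G x) ->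
  (forall x, 0 < x < 1 -> F n x @[n --> \oo] --> 0) ->
  ip (F n) (F n) @[n --> \oo] --> 0.
Proof.
move=> mF iG FG F0; apply: (ip_ae_dominated_cvg0 _ _ mF iG FG).
exists [set 0]; split; [exact: measurable_set1|exact: lebesgue_measure_set1|].
move=> x /= H; apply/eqP/negPn/negP => x0; apply: H.
rewrite in_itv/= => /andP[xge0 x1].
by apply: F0; rewrite lt_neqAle eq_sym x0 xge0.
Qed.

Lemma cvg0_le (u : nat -> R) (e : R) : u n @[n --> \oo] --> 0 -> 0 < e ->
  exists n, u n <= e.
Proof.
move=> u0 e0; have /cvgrPdist_le/(_ e e0)[n _ /(_ n (leqnn n))] := u0.
by rewrite /= sub0r normrN => une; exists n; exact: le_trans (ler_norm _) une.
Qed.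

(** * Truncation and approximation by bounded continuous functions *)

Definition clamp k y := Num.max (- k) (Num.min k y).

Lemma clamp_norm k y : 0 <= k -> `|clamp k y| <= k.
Proof.
move=> k0; rewrite ler_norml /clamp le_max lexx ge_max ge_min lexx.
by rewrite (le_trans _ k0)// oppr_le0.
Qed.

Lemma clamp_id k y : `|y| <= k -> clamp k y = y.
Proof.
by rewrite ler_norml => /andP[ky yk]; rewrite /clamp min_r// max_r.
Qed.

Lemma clamp_dist k y x : `|clamp k y - clamp k x| <= `|y - x|.
Proof.
rewrite /clamp; case: (leP k y) => ?; case: (leP k x) => ?;
case: (leP (- k) k) => ?; case: (leP (- k) y) => ?; case: (leP (- k) x) => ?;
rewrite ler_norml; apply/andP; split;
have := ler_norm (y - x); have := ler_norm (- (y - x)); rewrite normrN; lra.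
Qed.

Lemma clamp_sub_sq k y : 0 <= k -> (y - clamp k y) ^+ 2 <= y ^+ 2.
Proof.
move=> k0; rewrite /clamp.
by case: (leP k y) => ?; case: (leP (- k) k) => ?; case: (leP (- k) y) => ?; nra.
Qed.

Lemma measurable_clamp k f : measurable_fun D f ->
  measurable_fun D (fun x => clamp k (f x)).
Proof.
move=> mf; apply: (@measurable_maxr _ _ _ D (fun=> - k) (fun x => Num.min k (f x))) => //.
exact: (@measurable_minr _ _ _ D (fun=> k) f).
Qed.

Lemma continuous_clamp k f : continuous f -> continuous (fun x => clamp k (f x)).
Proof.
move=> cf x; apply/cvgrPdist_le => e e0.
have /cvgrPdist_le/(_ e e0) := cf x; apply: filterS => y.
exact/le_trans/clamp_dist.
Qed.

Lemma ip_clamp_approx f e : sqint f -> 0 < e ->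
  exists2 k, 0 <= k & ip (fun x => f x - clamp k (f x)) (fun x => f x - clamp k (f x)) <= e.
Proof.
move=> [mf if2] e0.
suff : ip (fun x => f x - clamp n%:R (f x)) (fun x => f x - clamp n%:R (f x))
    @[n --> \oo] --> 0.
  by move=> /cvg0_le/(_ e0)[n]; exists n%:R.
apply: (ip_dominated_cvg0 _ _ _ if2).
- by move=> n; apply: measurable_funB => //; exact: measurable_clamp.
- by move=> n x _; exact: clamp_sub_sq.
- move=> x _; apply: cvg_near_cst.
  exists (Num.bound `|f x|) => // n /= xn; rewrite clamp_id ?subrr//.
  by rewrite (le_trans (ltW (archi_boundP (normr_ge0 _))))// ler_nat.
Qed.

(** Truncate [f] at height [k], approximate the truncation in L^1 by a continuous function, and
    truncate that one too. Truncation is 1-Lipschitz and fixes [fk], and both functions are bounded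
    by [k], so the squared L^2 distance is at most [2 k] times the L^1 distance. *)
Lemma ip_continuous_approx f e : sqint f -> 0 < e ->
  exists g M, [/\ continuous g, forall x, `|g x| <= M &
    ip (fun x => f x - g x) (fun x => f x - g x) <= e].
Proof.
move=> sf e0; have e4 : 0 < e / 4 by lra.
have [k k0 fkle] := ip_clamp_approx _ _ sf e4.
pose fk x := clamp k (f x).
have mfk : measurable_fun D fk by apply: measurable_clamp; case: sf.
have sfk : sqint fk by apply: (@sqint_bounded _ _ k) => // x _; exact: clamp_norm.
have ifk : mu.-integrable D (EFin \o fk).
  apply: eq_integrable (sqintM _ _ sfk (@sqint_cst R 1)) => // x _ /=.
  by rewrite mulr1.
have muD : (mu D < +oo)%E by rewrite /= lebesgue_measure_itv/= lte_fin ltr01 ltry.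
have [//|g_ [cg ig /fine_cvg]] := approximation_continuous_integrable _ muD ifk.
(* Multiplied by [2 * k] this is at most [e / 4]; the summand 1 covers [k = 0]. *)
have e1 : 0 < e / (8 * (k + 1)) by rewrite divr_gt0// mulr_gt0//; lra.
move=> /cvg0_le/(_ e1)[n gn].
pose g x := clamp k (g_ n x).
have cg' : continuous g by exact: continuous_clamp.
have sg : sqint g.
  by apply: (@sqint_continuous_bounded _ _ k) => // x; exact: clamp_norm.
exists g, k; split => //; first by move=> x; exact: clamp_norm.
have sB1 : sqint (fun x => f x - fk x) by exact: sqintB.
have sB2 : sqint (fun x => fk x - g x) by exact: sqintB.
have ifg : mu.-integrable D (EFin \o (fun x => fk x - g_ n x)).
  by apply: eq_integrable (integrableB _ ifk (ig n)) => //.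
have le2 : ip (fun x => fk x - g x) (fun x => fk x - g x) <= e / 4.
  apply: (@le_trans _ _ (2 * k * (e / (8 * (k + 1))))); last first.
    rewrite mulrA ler_pdivrMr; last by rewrite mulr_gt0//; lra.
    by nra.
  apply: (@le_trans _ _ (2 * k * Rintegral mu D (fun x => `|fk x - g_ n x|))).
    rewrite -RintegralZl//; last exact: (integrable_norm ifg).
    rewrite /ip; apply: le_Rintegral => //.
    - exact: (sqintM _ _ sB2 sB2).
    - by apply: eq_integrable (integrableZl _ (2 * k) (integrable_norm ifg)) => //.
    - move=> x _; rewrite -expr2 -real_normK ?num_real// expr2.
      apply: ler_pM => //; last first.
        rewrite /g -{1}(clamp_id k (fk x)); first exact: clamp_dist.
        exact: clamp_norm.
      rewrite (le_trans (ler_normB _ _))// mulr_natl mulr2n lerD//.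
      + exact: clamp_norm.
      + exact: clamp_norm.
  rewrite ler_wpM2l//; first by lra.
have := ip_sqD _ _ sB1 sB2.
rewrite (@eq_ip _ _ (fun x => f x - g x) _ (fun x => f x - g x)).
- move=> /le_trans; apply; rewrite -/fk in fkle; lra.
- by move=> x _; rewrite addrA subrK.
- by move=> x _; rewrite addrA subrK.
Qed.

End DominatedSquares.

(** * Fejer means *)

Section FejerKernel.
Context {R : realType}.
Implicit Types (f g h : R -> R) (x y t e M : R) (l m n : nat).

Local Notation D := (`[0%R, 1%R[%classic : set R).
Local Notation mu := (@lebesgue_measure R).

(* The square modulus of \sum_(l < n) exp (2 pi i l t), divided by n. *)
Definition fejer n t : R :=
  n%:R^-1 * ((\sum_(l < n) cs l t) ^+ 2 + (\sum_(l < n) sn l t) ^+ 2).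

Lemma fejer_ge0 n t : 0 <= fejer n t.
Proof. by rewrite mulr_ge0 ?invr_ge0// addr_ge0// sqr_ge0. Qed.

Lemma csS n t : cs n.+1 t = cs 1 t * cs n t - sn 1 t * sn n t.
Proof. by rewrite csMcsB_snMsn add1n. Qed.

Lemma cs2Dsn2 n t : cs n t ^+ 2 + sn n t ^+ 2 = 1.
Proof. exact: cos2Dsin2. Qed.

(* The real and imaginary parts of (1 - z) * \sum_(l < n) z ^ l = 1 - z ^ n,
   with z = exp (2 pi i t). *)
Lemma dirichlet_telescope n t :
  (1 - cs 1 t) * (\sum_(l < n) cs l t) + sn 1 t * (\sum_(l < n) sn l t) = 1 - cs n t /\
  (1 - cs 1 t) * (\sum_(l < n) sn l t) - sn 1 t * (\sum_(l < n) cs l t) = - sn n t.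
Proof.
elim: n => [|n [IH1 IH2]]; first by rewrite !big_ord0 cs0 sn0; split; ring.
rewrite !big_ord_recr/=; split.
  by rewrite (csS n); move: IH1; lra.
by rewrite -(add1n n) snD; move: IH2; lra.
Qed.

(** Squared moduli of both sides of [(1 - z) * (1 + ... + z^(n-1)) = 1 - z^n], using
    [|1 - z|^2 = 2 (1 - cs 1 t)]. Without division the identity covers [z = 1] as well. *)
Lemma fejer_mul n t : (1 - cs 1 t) * fejer n t = n%:R^-1 * (1 - cs n t).
Proof.
have [H1 H2] := dirichlet_telescope n t; rewrite /fejer mulrCA; congr *%R.
set C := \sum_(l < n) cs l t in H1 H2 *; set S := \sum_(l < n) sn l t in H1 H2 *.
have e1 := cs2Dsn2 1 t; have en := cs2Dsn2 n t.
have H : ((1 - cs 1 t) * C + sn 1 t * S) ^+ 2 + ((1 - cs 1 t) * S - sn 1 t * C) ^+ 2 =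
   (1 - 2 * cs 1 t + (cs 1 t ^+ 2 + sn 1 t ^+ 2)) * (C ^+ 2 + S ^+ 2) by ring.
have H' : (1 - cs n t) ^+ 2 + (- sn n t) ^+ 2 =
   1 - 2 * cs n t + (cs n t ^+ 2 + sn n t ^+ 2) by ring.
rewrite H1 H2 e1 H' en in H; lra.
Qed.

Lemma fejer_mul_le n t : (1 - cs 1 t) * fejer n t <= 2 * n%:R^-1.
Proof.
rewrite fejer_mul mulrC ler_wpM2r ?invr_ge0//.
by have := cos_geN1 (2 * pi * n%:R * t); rewrite -/(cs n t); lra.
Qed.

Lemma fejerE n t : fejer n t = n%:R^-1 * \sum_(l < n) \sum_(m < n) cs (distn l m) t.
Proof.
rewrite /fejer !expr2 !big_distrlr/= -big_split/=; congr *%R.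
by apply: eq_bigr => l _; rewrite -big_split; apply: eq_bigr => m _; exact: csMcs_snMsn.
Qed.

(** The convolution of [g] with the Fejer kernel, expanded as a trigonometric polynomial so that
    orthogonality can be checked term by term. *)
Definition fejer_mean g n x : R := n%:R^-1 * \sum_(l < n) \sum_(m < n)
  (ip g (cs (distn l m)) * cs (distn l m) x + ip g (sn (distn l m)) * sn (distn l m) x).

Lemma sqint_csB l x : sqint (fun y => cs l (x - y)).
Proof.
under eq_fun do rewrite csB.
by apply: sqintD; apply: sqintZ; [exact: sqint_cs|exact: sqint_sn].
Qed.

Lemma sqint_fejer n x : sqint (fun y => fejer n (x - y)).
Proof.
under eq_fun do rewrite fejerE.
apply: sqintZ; apply: sqint_sum => l _; apply: sqint_sum => m _; exact: sqint_csB.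
Qed.

Lemma fejer_meanE g n x : sqint g -> fejer_mean g n x = ip g (fun y => fejer n (x - y)).
Proof.
move=> sg; rewrite (@eq_ip _ _ g _ (fun y => n%:R^-1 *
    \sum_(l < n) \sum_(m < n) cs (distn l m) (x - y)))//; last first.
  by move=> y _; rewrite fejerE.
have sc l := @sqint_csB l x.
have ss (l : 'I_n) : sqint (fun y => \sum_(m < n) cs (distn l m) (x - y)).
  by apply: sqint_sum.
rewrite ipZr//; last exact: sqint_sum.
rewrite ip_sumr//; congr *%R; apply: eq_bigr => l _.
rewrite ip_sumr//; apply: eq_bigr => m _; set d := distn l m.
have := @sqint_cs R d; have := @sqint_sn R d => sd cd.
rewrite (@eq_ip _ g g (fun y => cs d (x - y)) (fun y => cs d x * cs d y + sn d x * sn d y))//.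
  by rewrite ipDr ?ipZr//; [ring|exact: sqintZ..].
by move=> y _; rewrite csB.
Qed.

Lemma sqint_fejer_mean g n : sqint (fejer_mean g n).
Proof.
apply: sqintZ; apply: sqint_sum => l _; apply: sqint_sum => m _.
by apply: sqintD; apply: sqintZ; [exact: sqint_cs|exact: sqint_sn].
Qed.

Lemma fejer_mean_orth g n h : sqint h ->
  (forall l, (l < n)%N -> ip h (cs l) = 0 /\ ip h (sn l) = 0) ->
  ip h (fejer_mean g n) = 0.
Proof.
move=> sh h0.
have sT (l m : 'I_n) : sqint (fun x => ip g (cs (distn l m)) * cs (distn l m) x +
    ip g (sn (distn l m)) * sn (distn l m) x).
  by apply: sqintD; apply: sqintZ; [exact: sqint_cs|exact: sqint_sn].
have sS (l : 'I_n) : sqint (fun x => \sum_(m < n) (ip g (cs (distn l m)) *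
    cs (distn l m) x + ip g (sn (distn l m)) * sn (distn l m) x)).
  by apply: sqint_sum => m _; exact: sT.
rewrite ipZr//; last by apply: sqint_sum => l _; exact: sS.
rewrite ip_sumr// big1 ?mulr0// => l _; rewrite ip_sumr// big1// => m _.
have sc k := @sqint_cs R k; have ss k := @sqint_sn R k.
have dn : (distn l m < n)%N by have := ltn_ord l; have := ltn_ord m; rewrite /distn; lia.
have [c0 s0] := h0 _ dn.
by rewrite ipDr ?ipZr ?c0 ?s0 ?mulr0 ?addr0//; exact: sqintZ.
Qed.

(** The integral is the Fejer mean of the constant 1, where only the [n] diagonal terms [l = m]
    survive, each equal to 1. *)
Lemma Rintegral_fejer n x : (0 < n)%N -> Rintegral mu D (fun y => fejer n (x - y)) = 1.
Proof.
move=> n0; have := @fejer_meanE (fun=> 1) n x (@sqint_cst R 1).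
rewrite ipC ip_cst1 => <-; rewrite /fejer_mean.
rewrite (eq_bigr (fun=> 1)); last first.
  move=> l _; rewrite (bigD1 l)//= distnn ipC ip_cst1 Rintegral_cs cs0 sn0 eqxx mulr0 mul1r addr0.
  rewrite big1 ?addr0// => m ml.
  rewrite !(ipC (fun=> 1)) !ip_cst1 Rintegral_cs Rintegral_sn distn_eq0.
  have -> : (l == m :> nat) = false by apply/negP => /eqP/val_inj lm; rewrite lm eqxx in ml.
  by rewrite !mul0r addr0.
by rewrite sumr_const card_ord mulVf// pnatr_eq0 -lt0n.
Qed.

(** The kernel is nonnegative of integral 1, so the difference is an average of [g x - g y]. The
    weight [1 - cs 1 (x - y)] is the one that [fejer_mul_le] bounds against the kernel: [e] serves
    for [y] near [x], [M] for the others. *)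
Lemma fejer_mean_dist g n x e M : sqint g -> (0 < n)%N -> 0 <= M ->
  (forall y, D y -> `|g x - g y| <= e + M * (1 - cs 1 (x - y))) ->
  `|g x - fejer_mean g n x| <= e + M * (2 * n%:R^-1).
Proof.
move=> sg n0 M0 gM; have sF := sqint_fejer n x; have s1 := @sqint_cst R (g x).
have sB : sqint (fun y => g x - g y) by exact: sqintB.
have -> : g x - fejer_mean g n x = ip (fun y => g x - g y) (fun y => fejer n (x - y)).
  rewrite ipBl// fejer_meanE//; congr (_ - _).
  rewrite (@eq_ip _ (fun=> g x) (fun y => g x * 1) _ (fun y => fejer n (x - y)))//; last first.
    by move=> y _; rewrite mulr1.
  rewrite ipZl//; last exact: sqint_cst.
  by rewrite (ipC (fun=> 1)) ip_cst1 Rintegral_fejer// mulr1.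
have iB := sqintM _ _ sB sF.
rewrite (le_trans (le_normr_Rintegral _ iB))//.
have iF : mu.-integrable D (EFin \o (fun y => fejer n (x - y))).
  apply: eq_integrable (sqintM _ _ sF (@sqint_cst R 1)) => // y _ /=.
  by rewrite mulr1.
have i1 : mu.-integrable D (EFin \o (fun=> M * (2 * n%:R^-1))).
  have sM := @sqint_cst R (M * (2 * n%:R^-1)).
  apply: eq_integrable (sqintM _ _ sM (@sqint_cst R 1)) => // y _ /=.
  by rewrite mulr1.
have ie := @integrable_unitZ _ e _ iF.
have -> : e + M * (2 * n%:R^-1) =
    Rintegral mu D (fun y => e * fejer n (x - y) + M * (2 * n%:R^-1)).
  rewrite RintegralD// RintegralZl// Rintegral_fejer// mulr1 Rintegral_cst//=.
  by rewrite lebesgue_measure_itv/= lte_fin ltr01 oppr0 addr0 mulr1.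
apply: le_Rintegral => //.
- exact: integrable_norm iB.
- exact: integrable_unitD.
- move=> y Dy; rewrite normrM (ger0_norm (fejer_ge0 _ _)).
  apply: (le_trans (ler_wpM2r (fejer_ge0 n (x - y)) (gM y Dy))).
  rewrite mulrDl lerD2l -mulrA ler_wpM2l//; exact: fejer_mul_le.
Qed.

End FejerKernel.

(** * Convergence of Fourier sums in the mean *)

Section FourierApproximation.
Context {R : realType}.
Implicit Types (f g h : R -> R) (x y t e M : R) (l m n N : nat).

Local Notation D := (`[0%R, 1%R[%classic : set R).
Local Notation mu := (@lebesgue_measure R).

(** The cosine of [2 pi u] decreases on [[0, 1/2]] and is symmetric under [u -> 1 - u]. *)
Lemma cs1_decr d u : 0 <= d <= 2^-1 -> d <= u <= 1 - d -> cs 1 u <= cs 1 d :> R.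
Proof.
move=> /andP[d0 d2] /andP[du ud]; have p0 := pi_gt0 R.
have mono v : d <= v <= 2^-1 -> cs 1 v <= cs 1 d.
  move=> /andP[dv v2]; rewrite /cs !mulr1.
  rewrite leNgt (@ltr_cos R) ?in_itv/= -?leNgt; first by nra.
  - by apply/andP; split; nra.
  - by apply/andP; split; nra.
have [u2|u2] := leP u 2^-1; first by apply: mono; rewrite du.
have -> : cs 1 u = cs 1 (1 - u).
  by rewrite csB cs_at1 sn_at1 mul1r mul0r addr0.
by apply: mono; apply/andP; split; lra.
Qed.

Lemma cs1_lt1 d : 0 < d <= 2^-1 -> cs 1 d < 1 :> R.
Proof.
move=> /andP[d0 d2]; have p0 := pi_gt0 R.
rewrite -(@cos0 R) /cs mulr1 (@ltr_cos R) ?in_itv/=; first by nra.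
- by apply/andP; split; nra.
- by apply/andP; split; nra.
Qed.

Lemma cs1_norm u : cs 1 `|u| = cs 1 u :> R.
Proof.
by rewrite /cs; case: (ger0P u) => // _; rewrite mulrN cosN.
Qed.

Lemma fejer_mean_cvg g M x : continuous g -> (forall y, `|g y| <= M) -> 0 < x < 1 ->
  g x - fejer_mean g n.+1 x @[n --> \oo] --> 0.
Proof.
move=> cg gM /andP[x0 x1].
have M0 : 0 <= M by rewrite (le_trans _ (gM 0)).
have sg : sqint g by exact: sqint_continuous_bounded gM.
apply/cvgr0Pnorm_le => e e0; have e2 : 0 < e / 2 by lra.
have /cvgrPdist_le/(_ _ e2) := cg x; rewrite -filter_from_ballE => -[d0 /= d00 dg].
(* Besides [d < d0], the choice gives [|x - y| <= 1 - d] for all [y] in [[0, 1[]: a point far from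
   [x] is also far from its translates by 1. *)
pose d := Num.min (d0 / 2) (Num.min x (1 - x)).
have d_gt0 : 0 < d by rewrite !lt_min; apply/and3P; split; lra.
have dd0 : d < d0 by rewrite gt_min; apply/orP; left; lra.
have dx : d <= x by rewrite !ge_min lexx orbT.
have dx1 : d <= 1 - x by rewrite !ge_min lexx !orbT.
have d2 : d <= 2^-1 by lra.
have k0 : 0 < 1 - cs 1 d :> R by rewrite subr_gt0 cs1_lt1// d_gt0.
(* For [|x - y| >= d] the trivial bound [2 * M] is then at most [C * (1 - cs 1 (x - y))]. *)
pose C := 2 * M / (1 - cs 1 d).
have C0 : 0 <= C by rewrite divr_ge0 ?mulr_ge0// ltW.
have gC y : D y -> `|g x - g y| <= e / 2 + C * (1 - cs 1 (x - y)).
  rewrite /= in_itv/= => /andP[y0 y1].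
  have c1 : 0 <= 1 - cs 1 (x - y) by rewrite subr_ge0; exact: cos_le1.
  have [xy|xy] := ltP `|x - y| d.
    rewrite (le_trans (dg y _))//; first by rewrite /ball/= (lt_trans xy).
    by rewrite lerDl mulr_ge0.
  have : cs 1 (x - y) <= cs 1 d.
    rewrite -cs1_norm; apply: cs1_decr; first by rewrite ltW.
    by rewrite xy/= ler_norml; apply/andP; split; lra.
  move=> cd; have : 2 * M <= C * (1 - cs 1 (x - y)).
    rewrite /C mulrAC ler_pdivlMr//; apply: ler_wpM2l; lra.
  have := ler_normB (g x) (g y); have := gM x; have := gM y; lra.
have cvC : C * (2 * n.+1%:R^-1) @[n --> \oo] --> (0 : R).
  rewrite -(mulr0 (C * 2)); under eq_fun do rewrite mulrA.
  by apply: cvgM; [exact: cvg_cst|exact: cvg_harmonic].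
have /cvgr0Pnorm_le/(_ _ e2) := cvC; apply: filterS => n.
move=> /(le_trans (ler_norm _)) Cn.
apply: (le_trans (fejer_mean_dist _ _ _ _ _ sg (ltn0Sn n) C0 gC)).
by rewrite [leRHS]splitr lerD2l.
Qed.

Lemma fejer_mean_approx g M e : continuous g -> (forall y, `|g y| <= M) -> 0 < e ->
  exists n, ip (fun x => g x - fejer_mean g n x) (fun x => g x - fejer_mean g n x) <= e.
Proof.
move=> cg gM e0; have M0 : 0 <= M by rewrite (le_trans _ (gM 0)).
have sg : sqint g by exact: sqint_continuous_bounded gM.
suff : ip (fun x => g x - fejer_mean g n.+1 x) (fun x => g x - fejer_mean g n.+1 x)
    @[n --> \oo] --> 0.
  by move=> /cvg0_le/(_ e0)[n]; exists n.+1.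
have ic : mu.-integrable D (EFin \o (fun=> (2 * M) ^+ 2 : R)).
  by have [_] := @sqint_cst R (2 * M).
apply: (ip_dominated_cvg0 _ _ _ ic).
- by move=> n; have [] := sqintB _ _ sg (sqint_fejer_mean g n.+1).
(* The uniform bound [2 * M] comes from [fejer_mean_dist] with its far-point constant equal to 0. *)
- move=> n x _; rewrite -real_normK ?num_real// lerXn2r// ?nnegrE ?mulr_ge0//.
  have := @fejer_mean_dist _ g n.+1 x (2 * M) 0 sg isT (lexx 0).
  rewrite mul0r addr0; apply=> y _; rewrite mul0r addr0.
  have := ler_normB (g x) (g y); have := gM x; have := gM y; lra.
- by move=> x x01; exact: fejer_mean_cvg gM x01.
Qed.

(** The real form of the sum of [a_l exp (2 pi i l x)] over [0 < |l| < N]. The factor 2 pairs [l]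
    with [-l]; there is no constant term because [a_0 = 0]. *)
Definition fourier_sum f N x : R :=
  \sum_(1 <= l < N) (2 * fcos f l * cs l x + 2 * fsin f l * sn l x).

Lemma sqint_fourier_term f l :
  sqint (fun x => 2 * fcos f l * cs l x + 2 * fsin f l * sn l x).
Proof. by apply: sqintD; apply: sqintZ; [exact: sqint_cs|exact: sqint_sn]. Qed.

Lemma sqint_fourier_sum f N : sqint (fourier_sum f N).
Proof. by apply: sqint_sum => l _; exact: sqint_fourier_term. Qed.

Lemma sum_pick (F : nat -> R) N l : (0 < l < N)%N ->
  \sum_(1 <= k < N) F k * (k == l)%:R = F l.
Proof.
move=> lN; rewrite (eq_bigr (fun k => if k == l then F k else 0)).
  by rewrite -big_mkcond big_nat1_eq lN.
by move=> k _; case: eqP => _; rewrite ?mulr1 ?mulr0.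
Qed.

Lemma ip_fourier_sum_cs f N l : (l < N)%N -> Rintegral mu D f = 0 ->
  ip (fourier_sum f N) (cs l) = fcos f l.
Proof.
move=> lN f0; rewrite ip_suml; [|by move=> k _; exact: sqint_fourier_term|exact: sqint_cs].
have -> : \sum_(1 <= k < N) ip (fun x => 2 * fcos f k * cs k x + 2 * fsin f k * sn k x) (cs l)
   = \sum_(1 <= k < N) fcos f k * (k == l)%:R.
  apply: eq_big_nat => k /andP[k0 _].
  have sc := @sqint_cs R; have ss := @sqint_sn R.
  rewrite ipDl ?ipZl ?ip_cs_cs//; [|exact: sqintZ..].
  by rewrite (ipC (sn k)) ip_cs_sn; field.
(* For [l = 0] the left side vanishes term by term, and [fcos f 0] is the mean of [f], which is
   0. *)
have [l0|l0] := posnP l; last by apply: sum_pick; rewrite l0.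
rewrite big_nat_cond big1 => [|k /andP[/andP[k0 _] _]]; last first.
  by rewrite l0 gtn_eqF// mulr0.
rewrite l0 fcosE -f0 -ip_cst1; apply: eq_ip => // x _; by rewrite cs0.
Qed.

Lemma ip_fourier_sum_sn f N l : (l < N)%N ->
  ip (fourier_sum f N) (sn l) = fsin f l.
Proof.
move=> lN; rewrite ip_suml; [|by move=> k _; exact: sqint_fourier_term|exact: sqint_sn].
have -> : \sum_(1 <= k < N) ip (fun x => 2 * fcos f k * cs k x + 2 * fsin f k * sn k x) (sn l)
   = \sum_(1 <= k < N) fsin f k * (k == l)%:R.
  apply: eq_big_nat => k /andP[k0 _].
  have sc := @sqint_cs R; have ss := @sqint_sn R.
  rewrite ipDl ?ipZl ?ip_sn_sn//; [|exact: sqintZ..].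
  by rewrite ip_cs_sn; field.
have [l0|l0] := posnP l; last by apply: sum_pick; rewrite l0.
rewrite big_nat_cond big1 => [|k /andP[/andP[k0 _] _]]; last first.
  by rewrite l0 gtn_eqF// mulr0.
rewrite l0 fsinE (@eq_ip _ f f (sn 0) (fun x => 0 * sn 0 x))//.
  rewrite /ip (_ : (fun x => _) = fun=> 0) ?Rintegral_cst ?mul0r//.
  by apply/funext => x; rewrite mul0r mulr0.
by move=> x _; rewrite mul0r sn0.
Qed.

Lemma ip_fourier_sum f g N : sqint g -> ip (fourier_sum f N) g =
  \sum_(1 <= l < N) (2 * fcos f l * fcos g l + 2 * fsin f l * fsin g l).
Proof.
move=> sg; rewrite ip_suml//; last by move=> k _; exact: sqint_fourier_term.
apply: eq_bigr => k _; have sc := @sqint_cs R k; have ss := @sqint_sn R k.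
by rewrite ipDl ?ipZl//; [rewrite !fcosE !fsinE !(ipC g)|exact: sqintZ..].
Qed.

(** Expand the square norm of [f - g], which is nonnegative. The hypothesis holds when [f] is an
    orthogonal projection of [g]. *)
Lemma ip_le_of_proj f g : sqint f -> sqint g -> ip f f = ip f g -> ip f f <= ip g g.
Proof.
move=> sf sg fg; have sB : sqint (fun x => f x - g x) by exact: sqintB.
have := ip_ge0 (fun x => f x - g x).
rewrite ipBl// !ipBr// (ipC g f) -fg; lra.
Qed.

Section Remainder.
Variables (f : R -> R) (N : nat).
Hypotheses (sf : sqint f) (f0 : Rintegral mu D f = 0).
Let r x := f x - fourier_sum f N x.
Let sr : sqint r. Proof. by apply: sqintB => //; exact: sqint_fourier_sum. Qed.

Lemma fourier_rem_cs l : (l < N)%N -> ip r (cs l) = 0.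
Proof.
move=> lN; rewrite ipBl ?ip_fourier_sum_cs ?subrr//; first exact: sqint_fourier_sum.
exact: sqint_cs.
Qed.

Lemma fourier_rem_sn l : (l < N)%N -> ip r (sn l) = 0.
Proof.
move=> lN; rewrite ipBl ?ip_fourier_sum_sn ?subrr//; first exact: sqint_fourier_sum.
exact: sqint_sn.
Qed.

Lemma fourier_rem_sum : ip r (fourier_sum f N) = 0.
Proof.
rewrite ipC ip_fourier_sum// big_nat_cond big1// => l /andP[/andP[_ lN] _].
by rewrite (fcosE r) (fsinE r) fourier_rem_cs// fourier_rem_sn// !mulr0 addr0.
Qed.

(** The remainder is orthogonal to the partial sum, so its square norm is that of [f] minus
    [2 * \sum asq f l]; the factor 2 is then given away. *)
Lemma bessel : \sum_(1 <= l < N) asq f l <= ip f f.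
Proof.
have := ip_ge0 r; rewrite {2}/r ipBr//; last exact: sqint_fourier_sum.
rewrite fourier_rem_sum subr0 ipBl//; last exact: sqint_fourier_sum.
rewrite ip_fourier_sum//.
have -> : \sum_(1 <= l < N) (2 * fcos f l * fcos f l + 2 * fsin f l * fsin f l) =
    2 * \sum_(1 <= l < N) asq f l.
  by rewrite mulr_sumr; apply: eq_bigr => l _; rewrite /asq; ring.
have : 0 <= \sum_(1 <= l < N) asq f l.
  by apply: sumr_ge0 => l _; rewrite addr_ge0// sqr_ge0.
lra.
Qed.

(* h stands for a trigonometric polynomial of degree less than N. *)
Lemma fourier_rem_best h : sqint h -> ip r h = 0 ->
  ip r r <= ip (fun x => f x - h x) (fun x => f x - h x).
Proof.
move=> sh rh; have sB : sqint (fun x => f x - h x) by exact: sqintB.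
have rr : ip r r = ip r (fun x => f x - h x).
  rewrite [RHS]ipBr// rh subr0 {2}/r ipBr// ?fourier_rem_sum ?subr0//.
  exact: sqint_fourier_sum.
exact: ip_le_of_proj.
Qed.

End Remainder.

(** A Fejer mean of a bounded continuous approximant is a trigonometric polynomial close to [f]; the
    partial Fourier sum of the same degree is at least as close. *)
Lemma fourier_approx f e : sqint f -> Rintegral mu D f = 0 -> 0 < e ->
  exists N, ip (fun x => f x - fourier_sum f N x) (fun x => f x - fourier_sum f N x) <= e.
Proof.
move=> sf f0 e0; have e4 : 0 < e / 4 by lra.
have [g [M [cg gM fg]]] := ip_continuous_approx _ _ sf e4.
have [N gN] := fejer_mean_approx _ _ _ cg gM e4.
have sg : sqint g by exact: sqint_continuous_bounded gM.
have sF := sqint_fejer_mean g N.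
exists N; apply: (@le_trans _ _ (ip (fun x => f x - fejer_mean g N x)
    (fun x => f x - fejer_mean g N x))).
  apply: fourier_rem_best => //; apply: fejer_mean_orth.
    by apply: sqintB => //; exact: sqint_fourier_sum.
  by move=> l lN; rewrite fourier_rem_cs ?fourier_rem_sn.
have := ip_sqD _ _ (sqintB _ _ sf sg) (sqintB _ _ sg sF).
rewrite (@eq_ip _ _ (fun x => f x - fejer_mean g N x) _ (fun x => f x - fejer_mean g N x)).
- by move=> /le_trans; apply; lra.
- by move=> x _; rewrite addrA subrK.
- by move=> x _; rewrite addrA subrK.
Qed.

End FourierApproximation.

(** * Dilations of periodic functions *)

Section Dilation.
Context {R : realType}.
Implicit Types (f g : R -> R) (k n i : nat).

Local Notation D := (`[0%R, 1%R[%classic : set R).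
Local Notation mu := (@lebesgue_measure R).

(** Maps the piece [[i / k, (i + 1) / k[] onto [[0, 1[]. *)
Definition affine_nat k i (x : measurableTypeR R) : measurableTypeR R := k%:R * x - i%:R.

Lemma measurable_affine_nat k i : measurable_fun setT (affine_nat k i).
Proof.
by apply: measurable_funB => //; exact: measurable_funM.
Qed.

Lemma pushforward_affine_nat k i (A : set R) : (0 < k)%N -> measurable A ->
  pushforward (mscale (NngNum (ler0n R k)) mu) (affine_nat k i) A = mu A.
Proof.
move=> k0 mA; have mf := measurable_affine_nat k i.
apply/esym/lebesgue_measure_unique => //= _ [[a b]] _ <-.
rewrite /pushforward /mscale/=.
have k0' : 0 < k%:R :> R by rewrite ltr0n.
rewrite (_ : _ @^-1` _ = `](a + i%:R) / k%:R, (b + i%:R) / k%:R]%classic); last first.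
  apply/seteqP; split => x /=; rewrite !in_itv/= /affine_nat ltr_pdivrMr// ler_pdivlMr// (mulrC x);
  by move=> /andP[? ?]; apply/andP; split; lra.
rewrite !lebesgue_measure_itv/= !lte_fin ltr_pM2r ?invr_gt0// ltrD2r.
case: ifPn => ab; last by rewrite mule0.
rewrite -!EFinB -EFinM; congr EFin.
by field; rewrite gt_eqF.
Qed.

Lemma integral_affine_nat k i (g : R -> \bar R) : (0 < k)%N -> measurable_fun setT g ->
  (forall x, 0 <= g x)%E ->
  (k%:R%:E * \int[mu]_(x in `[(i%:R / k%:R)%R, (i.+1%:R / k%:R)%R[) g (k%:R * x - i%:R)%R =
   \int[mu]_(x in D) g x)%E.
Proof.
move=> k0 mg g0; have mf := measurable_affine_nat k i.
have k0' : 0 < k%:R :> R by rewrite ltr0n.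
transitivity (\int[pushforward (mscale (NngNum (ler0n R k)) mu) (affine_nat k i)]_(x in D) g x)%E.
  rewrite ge0_integral_pushforward//=; last exact: measurable_funTS.
  have -> : affine_nat k i @^-1` D = `[(i%:R / k%:R)%R, (i.+1%:R / k%:R)%R[%classic.
    apply/seteqP; split => x /=;
    rewrite !in_itv/= /affine_nat ler_pdivrMr// ltr_pdivlMr// (mulrC x) -(natr1 i);
    by move=> /andP[? ?]; apply/andP; split; lra.
  rewrite ge0_integral_mscale//=.
  apply: measurable_funTS; apply: measurableT_comp => //.
by apply: eq_measure_integral => //= A mA _; exact: pushforward_affine_nat.
Qed.

(** Cut [[0, 1[] into [k] equal pieces; by periodicity each carries [1 / k] of the integral of [g].
    Values in [[0, +oo]] are allowed so that integrability of a dilate can be deduced. *)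
Lemma integral_dilation k (g : R -> \bar R) : (0 < k)%N -> measurable_fun setT g ->
  (forall x, 0 <= g x)%E -> (forall x, g (x + 1) = g x) ->
  (\int[mu]_(x in D) g (k%:R * x)%R = \int[mu]_(x in D) g x)%E.
Proof.
move=> k0 mg g0 g1; have k0' : 0 < k%:R :> R by rewrite ltr0n.
have gn n x : g (x - n%:R) = g x.
  elim: n => [|n IH]; first by rewrite subr0.
  by rewrite -natr1 opprD addrA -[LHS]g1 subrK.
have mgk : measurable_fun setT (fun x : R => g (k%:R * x)).
  by apply: measurableT_comp => //; exact: measurable_funM.
have piece i : (k%:R%:E * \int[mu]_(x in `[(i%:R / k%:R)%R, (i.+1%:R / k%:R)%R[) g (k%:R * x)%R =
   \int[mu]_(x in D) g x)%E.
  rewrite -(@integral_affine_nat k i)//; congr (_ * _)%E.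
  by apply: eq_integral => x _; rewrite gn.
have pieces n : (k%:R%:E * \int[mu]_(x in `[0%R, (n%:R / k%:R)%R[) g (k%:R * x)%R =
   n%:R%:E * \int[mu]_(x in D) g x)%E.
  elim: n => [|n IH].
    by rewrite mul0r set_itvco0 integral_set0 mule0 mul0e.
  have n0k : 0 <= n%:R / k%:R :> R by rewrite divr_ge0.
  have nk : n%:R / k%:R <= n.+1%:R / k%:R :> R by rewrite ler_pM2r ?invr_gt0// ler_nat.
  rewrite (@itv_bndbnd_setU _ _ _ (BLeft (n%:R / k%:R)))//.
  rewrite ge0_integral_setU//=.
  - rewrite ge0_muleDr; [|by apply: integral_ge0..].
    by rewrite IH piece -natr1 EFinD ge0_muleDl ?mul1e// lee_fin.
  - exact: measurable_funTS.
  - apply/disj_setPS => y [/=]; rewrite !in_itv/= => /andP[_ yn] /andP[ny _].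
    by move: (lt_le_trans yn ny); rewrite ltxx.
have := pieces k; rewrite divff ?gt_eqF// => /(congr1 (fun z => (k%:R^-1)%:E * z)%E).
by rewrite !muleA -EFinM mulVf ?gt_eqF// !mul1e.
Qed.

Lemma ip_dilation k f : (0 < k)%N -> measurable_fun setT f -> (forall x, f (x + 1) = f x) ->
  sqint f -> sqint (fun x => f (k%:R * x)) /\
  ip (fun x => f (k%:R * x)) (fun x => f (k%:R * x)) = ip f f.
Proof.
move=> k0 mf f1 sf.
have mk : measurable_fun setT (fun x : R => f (k%:R * x)).
  by apply: measurableT_comp => //; exact: measurable_funM.
have E : (\int[mu]_(x in D) (f (k%:R * x) ^+ 2)%:E = \int[mu]_(x in D) (f x ^+ 2)%:E)%E.
  rewrite -(@integral_dilation k (fun x => (f x ^+ 2)%:E))//.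
  - by apply/measurable_EFinP; exact: measurable_funX.
  - by move=> x; rewrite lee_fin sqr_ge0.
  - by move=> x; rewrite f1.
have sk : sqint (fun x => f (k%:R * x)).
  split; first exact: measurable_funTS.
  apply/integrableP; split.
    by apply/measurable_EFinP; apply: measurable_funX; exact: measurable_funTS.
  under eq_integral do rewrite /= ger0_norm ?sqr_ge0//.
  by rewrite E integral_sqE// ltry.
by split => //; move: E; rewrite !integral_sqE// => -[].
Qed.

End Dilation.

(** * Block estimates *)

Section BlockEstimate.
Local Set Implicit Arguments.
Local Unset Strict Implicit.
Context {R : realType}.
Implicit Types (f g h : R -> R) (x e : R) (c : nat -> R) (j k l m n p q N : nat).

Local Notation D := (`[0%R, 1%R[%classic : set R).
Local Notation mu := (@lebesgue_measure R).

(** Charge each [j] to some [t] with [phi t = j]. As [r] has no repetitions, every [t] is charged at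
    most once. *)
Lemma sum_surj_le (J T : eqType) (r : seq J) (s : seq T) (phi : T -> J)
    (G : J -> R) (F : T -> R) : uniq r -> (forall t, 0 <= F t) ->
  (forall j : J, j \in r -> exists t : T, [/\ t \in s, phi t = j & G j <= F t]) ->
  \sum_(j <- r) G j <= \sum_(t <- s) F t.
Proof.
move=> ur F0 Gr.
apply: (@le_trans _ _ (\sum_(j <- r) \sum_(t <- s) (phi t == j)%:R * F t)).
  rewrite big_seq [leRHS]big_seq; apply: ler_sum => j jr; have [t [ts tj Gj]] := Gr j jr.
  apply: (le_trans Gj); rewrite (big_rem t ts)/= tj eqxx mul1r lerDl.
  by apply: sumr_ge0 => u _; rewrite mulr_ge0.
rewrite exchange_big/=; apply: ler_sum => t _; rewrite -mulr_suml.
rewrite -[leRHS]mul1r ler_wpM2r// -natr_sum lern1.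
rewrite (eq_bigr (fun j : J => if pred1 (phi t) j then 1%N else 0%N)); last first.
  by move=> j _ /=; rewrite eq_sym; case: eqP.
by rewrite -big_mkcond/= sum1_count count_uniq_mem// leq_b1.
Qed.

Lemma asq_ge0 f l : 0 <= asq f l.
Proof. by rewrite addr_ge0// sqr_ge0. Qed.

Lemma sum_asq_mul_le f m n : (0 < m)%N ->
  \sum_(1 <= t < n) asq f (m * t) <= \sum_(1 <= l < m * n) asq f l.
Proof.
move=> m0; apply: (@sum_surj_le _ _ _ _ (fun l => l %/ m)%N) => //.
- exact: iota_uniq.
- by move=> l; exact: asq_ge0.
move=> t; rewrite mem_index_iota => /andP[t0 tn]; exists (m * t)%N; split => //.
- by rewrite mem_index_iota muln_gt0 m0 t0/= ltn_pmul2l.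
- by rewrite mulKn.
Qed.

Lemma nondecreasing_sum_asq f m :
  nondecreasing_seq (fun n => \sum_(1 <= t < n) asq f (m * t)).
Proof.
apply/nondecreasing_seqP => n; case: n => [|n]; first by rewrite !big_geq.
by rewrite [leRHS]big_nat_recr//= lerDl asq_ge0.
Qed.

(** By Bessel's inequality the nondecreasing partial sums are bounded, so the [limn] in [gfun] is a
    genuine limit and dominates them. *)
Lemma gfun_ge f m n : sqint f -> Rintegral mu D f = 0 -> (0 < m)%N ->
  \sum_(1 <= t < n) asq f (m * t) <= gfun f m.
Proof.
move=> sf f0 m0; apply: (nondecreasing_cvgn_le (nondecreasing_sum_asq f m)).
apply: nondecreasing_is_cvgn; first exact: nondecreasing_sum_asq.
exists (ip f f) => _ [N _ <-]; apply: (le_trans (sum_asq_mul_le _ _ m0)).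
exact: bessel.
Qed.

Lemma gfun_ge0 f m : sqint f -> Rintegral mu D f = 0 -> (0 < m)%N -> 0 <= gfun f m.
Proof. by move=> sf f0 m0; apply: le_trans (gfun_ge 0 sf f0 m0); rewrite big_geq. Qed.

(** Cancelling the gcd, [j] divides [k * l] exactly when [j / gcd(j, k)] divides [l]. *)
Lemma sum_asq_dvd_le f j k N : sqint f -> Rintegral mu D f = 0 -> (0 < j)%N -> (0 < k)%N ->
  \sum_(1 <= l < N) asq f l * (j %| k * l)%:R <= gfun f (j %/ gcdn j k).
Proof.
move=> sf f0 j0 k0; set m := (j %/ gcdn j k)%N.
have g0 : (0 < gcdn j k)%N by rewrite gcdn_gt0 j0.
have m0 : (0 < m)%N by rewrite divn_gt0// dvdn_leq// dvdn_gcdl.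
have jE : j = (m * gcdn j k)%N by rewrite divnK// dvdn_gcdl.
have kE : k = (k %/ gcdn j k * gcdn j k)%N by rewrite divnK// dvdn_gcdr.
have mk : coprime m (k %/ gcdn j k).
  rewrite /coprime -(eqn_pmul2r g0) mul1n muln_gcdl; apply/eqP.
  by rewrite -jE -kE.
have jkl l : (j %| k * l)%N = (m %| l)%N.
  by rewrite {1}jE {2}kE mulnAC dvdn_pmul2r// Gauss_dvdr.
apply: le_trans (gfun_ge N sf f0 m0).
under eq_bigr do rewrite jkl mulr_natr mulrb.
rewrite -big_mkcond -big_filter.
apply: (@sum_surj_le _ _ _ _ (fun t => m * t)%N) => //.
- by rewrite filter_uniq// iota_uniq.
- by move=> t; exact: asq_ge0.
move=> l; rewrite mem_filter mem_index_iota => /and3P[/dvdnP[t ->] l0 lN].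
exists t; split => //; last by rewrite mulnC.
- rewrite mem_index_iota; move: l0; rewrite muln_gt0 => /andP[-> _]/=.
  by rewrite (leq_ltn_trans _ lN)// leq_pmulr.
- by rewrite mulnC.
Qed.

(** The pair [d = k / gcd], [i = j / gcd] determines [j] as [i * (k / d)], and [j <= 2 k] turns into
    [i <= 2 d]. *)
Lemma sum_gcd_le (g : nat -> R) k n : (forall m, (0 < m)%N -> 0 <= g m) -> (0 < k)%N ->
  (* The last index of the sum is [n - 1], hence at most [2 * k]. *)
  (n <= (2 * k).+1)%N -> \sum_(1 <= j < n) g (j %/ gcdn j k)%N <=
  \sum_(d <- divisors k) \sum_(1 <= i < (2 * d).+1) g i.
Proof.
move=> g0 k0 nk; pose g' m := if (0 < m)%N then g m else 0.
have gE a b : (0 < a)%N -> \sum_(a <= i < b) g i = \sum_(a <= i < b) g' i.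
  by move=> a0; apply: eq_big_nat => i /andP[ai _]; rewrite /g' (leq_trans a0 ai).
under [leRHS]eq_bigr do rewrite gE//.
pose s := [seq (d, i) | d <- divisors k, i <- index_iota 1 (2 * d).+1].
have -> : \sum_(d <- divisors k) \sum_(1 <= i < (2 * d).+1) g' i = \sum_(t <- s) g' t.2.
  by rewrite /s big_allpairs_dep.
apply: (@sum_surj_le _ _ _ _ (fun t => t.2 * (k %/ t.1))%N).
- exact: iota_uniq.
- by move=> t; rewrite /g'; case: ifP => // ?; exact: g0.
move=> j; rewrite mem_index_iota => /andP[j0 jn].
have gcd0 : (0 < gcdn j k)%N by rewrite gcdn_gt0 j0.
have jE : j = (j %/ gcdn j k * gcdn j k)%N by rewrite divnK// dvdn_gcdl.
have kE : k = (k %/ gcdn j k * gcdn j k)%N by rewrite divnK// dvdn_gcdr.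
have j'0 : (0 < j %/ gcdn j k)%N by rewrite divn_gt0// dvdn_leq// dvdn_gcdl.
exists (k %/ gcdn j k, j %/ gcdn j k)%N; split => /=.
- apply/allpairsPdep; exists (k %/ gcdn j k)%N, (j %/ gcdn j k)%N; split => //.
    by rewrite -dvdn_divisors// dvdn_div// dvdn_gcdr.
  rewrite mem_index_iota j'0 ltnS -(leq_pmul2r gcd0) -mulnA -jE -kE.
  by rewrite -ltnS (leq_trans jn).
- rewrite [RHS]jE; congr muln; rewrite {1}kE mulKn//.
  by rewrite divn_gt0// dvdn_leq// dvdn_gcdr.
- by rewrite /g' j'0.
Qed.

(** Orthogonality leaves only pairs of equal frequency, each with factor 1/2. Then
    [A t * A u <= (A t ^ 2 + A u ^ 2) / 2], likewise for [B], and the symmetry in [t] and [u] merges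
    the two halves. *)
Lemma ip_trig_le (T : eqType) (s : seq T) (A B : T -> R) (w : T -> nat) (Q : R -> R) :
  (forall t, t \in s -> 0 < w t)%N ->
  Q = (fun x => \sum_(t <- s) (A t * cs (w t) x + B t * sn (w t) x)) ->
  ip Q Q <= 2^-1 * \sum_(t <- s) \sum_(u <- s) (A t ^+ 2 + B t ^+ 2) * (w t == w u)%:R.
Proof.
move=> w0 QE; have sc := @sqint_cs R; have ss := @sqint_sn R.
have sT t : sqint (fun x => A t * cs (w t) x + B t * sn (w t) x).
  by apply: sqintD; exact: sqintZ.
have sQ : sqint Q by rewrite QE; apply: sqint_sum.
have -> : ip Q Q = \sum_(t <- s) \sum_(u <- s)
    (A t * A u + B t * B u) * (w t == w u)%:R / 2.
  rewrite {1}QE ip_suml//; apply: eq_big_seq => t ts.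
  rewrite QE ip_sumr//; apply: eq_bigr => u _.
  rewrite ipDl ?ipZl//; [|exact: sqintZ..].
  rewrite !ipDr ?ipZr//; try exact: sqintZ.
  by rewrite ip_cs_cs ?ip_sn_sn ?w0// (ipC (sn _)) !ip_cs_sn; ring.
rewrite mulr_sumr.
have -> : \sum_(t <- s) 2^-1 * (\sum_(u <- s) (A t ^+ 2 + B t ^+ 2) * (w t == w u)%:R) =
  \sum_(t <- s) \sum_(u <- s) (4^-1 * (A t ^+ 2 + B t ^+ 2) * (w t == w u)%:R
     + 4^-1 * (A u ^+ 2 + B u ^+ 2) * (w t == w u)%:R).
  under [RHS]eq_bigr do rewrite big_split/=.
  rewrite big_split/=.
  rewrite [X in _ + X]exchange_big/= -big_split/=; apply: eq_bigr => t _.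
  rewrite mulr_sumr -big_split/=; apply: eq_bigr => u _.
  by rewrite (eq_sym (w u)); field.
apply: ler_sum => t _; apply: ler_sum => u _; case: (_ == _); rewrite ?mulr0 ?mul0r ?addr0//.
rewrite !mulr1; have := sqr_ge0 (A t - A u); have := sqr_ge0 (B t - B u); lra.
Qed.

Lemma sum_eq_mul_le j m N : (0 < j)%N ->
  \sum_(1 <= l < N) (m == j * l)%N%:R <= (j %| m)%:R :> R.
Proof.
move=> j0; have [/dvdnP[t ->]|jm] := boolP (j %| m)%N.
  under eq_bigr do rewrite mulnC eqn_pmul2l// eq_sym.
  rewrite (eq_bigr (fun l => if l == t then 1 else 0)); last by move=> l _; case: eqP.
  by rewrite -big_mkcond big_nat1_eq; case: ifP.
rewrite big1// => l _; case: eqP => // mE; by rewrite mE dvdn_mulr in jm.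
Qed.

Lemma cs_mul k l x : cs l (k%:R * x) = cs (k * l) x.
Proof. by rewrite /cs natrM; congr cos; ring. Qed.

Lemma sn_mul k l x : sn l (k%:R * x) = sn (k * l) x.
Proof. by rewrite /sn natrM; congr sin; ring. Qed.

Lemma hfun_ge f k : sqint f -> Rintegral mu D f = 0 -> (0 < k)%N ->
  \sum_(d <- divisors k) Gfun f d <= hfun f k.
Proof.
move=> sf f0 k0; rewrite /hfun big_seq [leRHS]big_seq.
apply: ler_sum => d; rewrite -dvdn_divisors// => dk.
by rewrite lerDr mulr_ge0// gfun_ge0// (dvdn_gt0 k0).
Qed.

Lemma Gfun_ge0 f d : sqint f -> Rintegral mu D f = 0 -> 0 <= Gfun f d.
Proof.
move=> sf f0; rewrite /Gfun big_nat_cond; apply: sumr_ge0 => i /andP[/andP[i0 _] _].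
exact: gfun_ge0.
Qed.

Lemma hfun_ge0 f k : sqint f -> Rintegral mu D f = 0 -> (0 < k)%N -> 0 <= hfun f k.
Proof.
move=> sf f0 k0; apply: (le_trans _ (hfun_ge sf f0 k0)).
by apply: sumr_ge0 => d _; exact: Gfun_ge0.
Qed.

Lemma block_fourier_le f c p q N : sqint f -> Rintegral mu D f = 0 -> (0 < p)%N ->
  (q <= (2 * p).+1)%N ->
  forall Q : R -> R, Q = (fun x => \sum_(p <= k < q) c k * fourier_sum f N (k%:R * x)) ->
  ip Q Q <= 2 * \sum_(p <= k < q) c k ^+ 2 * hfun f k.
Proof.
move=> sf f0 p0 qp Q QE.
pose s := [seq (k, l) | k <- index_iota p q, l <- index_iota 1 N].
pose A (t : nat * nat) := 2 * c t.1 * fcos f t.2.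
pose B (t : nat * nat) := 2 * c t.1 * fsin f t.2.
pose w (t : nat * nat) := (t.1 * t.2)%N.
have w0 t : t \in s -> (0 < w t)%N.
  move=> /allpairsP[[k l]/= [+ + ->]]; rewrite !mem_index_iota => /andP[pk _] /andP[l0 _].
  by rewrite muln_gt0 /= l0 (leq_trans p0 pk).
have {}QE : Q = fun x => \sum_(t <- s) (A t * cs (w t) x + B t * sn (w t) x).
  rewrite QE; apply/funext => x; rewrite /s big_allpairs; apply: eq_bigr => k _.
  rewrite /fourier_sum mulr_sumr; apply: eq_bigr => l _.
  by rewrite cs_mul sn_mul /A /B /w/=; ring.
apply: (le_trans (ip_trig_le w0 QE)).
rewrite /s big_allpairs !mulr_sumr big_nat_cond [leRHS]big_nat_cond.
apply: ler_sum => k /andP[/andP[pk kq] _].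
have k0 : (0 < k)%N by exact: leq_trans pk.
have ck0 : 0 <= 2 * c k ^+ 2 by rewrite mulr_ge0// sqr_ge0.
(* The intermediate bound gathers the interactions of a fixed [k] with the whole block. Every
   [j < q] satisfies [j <= 2 p <= 2 k], as [sum_gcd_le] requires. *)
apply: (@le_trans _ _ (2 * (c k ^+ 2 * \sum_(p <= j < q) gfun f (j %/ gcdn j k)%N))); last first.
  rewrite ler_pM2l// ler_wpM2l ?sqr_ge0//.
  apply: (le_trans _ (hfun_ge sf f0 k0)).
  apply: (le_trans _ (sum_gcd_le _ k0 (n := q) _)); last 2 first.
    by move=> m m0; exact: gfun_ge0.
    by rewrite (leq_trans qp)// ltnS leq_mul2l pk orbT.
  have [pq|qp'] := leqP p q; last first.
    by rewrite big_geq ?(ltnW qp')// big_nat_cond sumr_ge0// => i /andP[/andP[i0 _] _];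
      rewrite gfun_ge0// divn_gt0 ?gcdn_gt0 ?i0// dvdn_leq// dvdn_gcdl.
  rewrite [leRHS](big_cat_nat p0 pq)/= lerDr big_nat_cond sumr_ge0// => i /andP[/andP[i0 _] _].
  by rewrite gfun_ge0// divn_gt0 ?gcdn_gt0 ?i0// dvdn_leq// dvdn_gcdl.
(* For given [k], [l] and [j], at most one [l'] solves [k l = j l'], and only if [j] divides [k l].
   The squared coefficients are [4 * c k ^ 2 * asq f l], halved by [ip_trig_le]. *)
apply: (@le_trans _ _ (\sum_(1 <= l < N) \sum_(p <= j < q)
    2 * c k ^+ 2 * (asq f l * (j %| k * l)%:R))).
  rewrite mulr_sumr; apply: ler_sum => l _.
  rewrite /s big_allpairs mulr_sumr big_nat_cond [leRHS]big_nat_cond.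
  apply: ler_sum => j /andP[/andP[pj jq] _]; rewrite -mulr_sumr/= /w/=.
  have -> : A (k, l) ^+ 2 + B (k, l) ^+ 2 = 2 * (2 * c k ^+ 2 * asq f l).
    by rewrite /A /B /asq/=; ring.
  have := @sum_eq_mul_le j (k * l) N (leq_trans p0 pj).
  by move=> /(ler_wpM2l (mulr_ge0 ck0 (asq_ge0 f l))); lra.
rewrite exchange_big/= !mulr_sumr big_nat_cond [leRHS]big_nat_cond.
apply: ler_sum => j /andP[/andP[pj jq] _].
rewrite -mulr_sumr mulrA ler_wpM2l//.
by apply: sum_asq_dvd_le => //; exact: leq_trans pj.
Qed.

(** Iterates [ip_sqD]. The exponential constant is harmless: the bound serves for an error term that
    can be made arbitrarily small while the block stays fixed. *)
Lemma ip_sum_le (T : Type) (s : seq T) (F : T -> R -> R) : (forall t, sqint (F t)) ->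
  ip (fun x => \sum_(t <- s) F t x) (fun x => \sum_(t <- s) F t x) <=
  2 ^+ size s * \sum_(t <- s) ip (F t) (F t).
Proof.
move=> sF; elim: s => [|t s IH].
  by rewrite ip_suml ?big_nil ?mulr0//; exact: sqint_sum.
under eq_fun do rewrite big_cons.
have sS : sqint (fun x => \sum_(u <- s) F u x) by exact: sqint_sum.
apply: (le_trans (ip_sqD _ _ (sF t) sS)).
have e1 : 1 <= 2 ^+ size s :> R by rewrite exprn_ege1// ler1n.
have := mulr_ge0 (ip_ge0 (F t)) (_ : 0 <= 2 ^+ size s - 1 :> R).
rewrite subr_ge0 => /(_ e1); move: IH; rewrite big_cons/= exprS; lra.
Qed.

(** * From trigonometric polynomials to general square-integrable functions *)

Lemma fourier_sumD1 f N x : fourier_sum f N (x + 1) = fourier_sum f N x.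
Proof.
apply: eq_bigr => l _; rewrite -[in RHS](addrK 1 x) csB snB cs_at1 sn_at1.
by rewrite !mulr1 !mulr0 subr0 addr0.
Qed.

Lemma measurable_fourier_sum f N : measurable_fun setT (fourier_sum f N).
Proof.
apply: measurable_sum => l; apply: measurable_funD; apply: measurable_funM => //.
- by apply: continuous_measurable_fun; exact: continuous_cs.
- by apply: continuous_measurable_fun; exact: continuous_sn.
Qed.

Lemma L2T0_sqint f : L2T0 f -> [/\ measurable_fun setT f, forall x, f (x + 1) = f x,
  sqint f & Rintegral mu D f = 0].
Proof.
move=> [mf [f1 [f2 f0]]]; split => //; split; first exact: measurable_funTS.
apply/integrableP; split.
  by apply/measurable_EFinP; apply: measurable_funX; exact: measurable_funTS.
by under eq_integral do rewrite /= ger0_norm ?sqr_ge0//.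
Qed.

Lemma block_le f c p q : L2T0 f -> (0 < p)%N -> (q <= (2 * p).+1)%N ->
  sqint (fun x => \sum_(p <= k < q) c k * f (k%:R * x)) /\
  ip (fun x => \sum_(p <= k < q) c k * f (k%:R * x))
     (fun x => \sum_(p <= k < q) c k * f (k%:R * x)) <=
  4 * \sum_(p <= k < q) c k ^+ 2 * hfun f k.
Proof.
move=> /L2T0_sqint[mf f1 sf f0] p0 qp.
have dil (g : R -> R) : measurable_fun setT g -> (forall x, g (x + 1) = g x) -> sqint g ->
    forall k, (p <= k < q)%N -> sqint (fun x => g (k%:R * x)) /\
      ip (fun x => g (k%:R * x)) (fun x => g (k%:R * x)) = ip g g.
  by move=> mg g1 sg k /andP[pk _]; apply: ip_dilation => //; exact: leq_trans pk.
pose u (g : R -> R) k x := if (p <= k < q)%N then c k * g (k%:R * x) else 0.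
have uE (g : R -> R) x : \sum_(p <= k < q) c k * g (k%:R * x) = \sum_(p <= k < q) u g k x.
  by apply: eq_big_nat => k kpq; rewrite /u kpq.
have su (g : R -> R) : measurable_fun setT g -> (forall x, g (x + 1) = g x) -> sqint g ->
    forall k, sqint (u g k).
  move=> mg g1 sg k; rewrite /u; case kpq: (p <= k < q)%N; last exact: sqint_cst.
  by apply: sqintZ; have [] := dil g mg g1 sg k kpq.
have sS (g : R -> R) : measurable_fun setT g -> (forall x, g (x + 1) = g x) -> sqint g ->
    sqint (fun x => \sum_(p <= k < q) c k * g (k%:R * x)).
  move=> mg g1 sg; under eq_fun do rewrite uE.
  by apply: sqint_sum => k _; exact: su.
split; first exact: sS.
set B := fun x => _; set X := \sum_(p <= k < q) c k ^+ 2 * hfun f k.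
pose K := 2 ^+ size (index_iota p q) * \sum_(p <= k < q) c k ^+ 2.
have K0 : 0 <= K by rewrite mulr_ge0//; apply: sumr_ge0 => k _; exact: sqr_ge0.
apply/ler_addgt0Pr => e e0.
(* With this precision the error part costs at most [e / 2]. The factor 2 of [ip_sqD] then gives
   [e], and turns the constant 2 of the polynomial case into 4. *)
have eK : 0 < e / (2 * (K + 1)) by apply: divr_gt0 => //; lra.
have [N fN] := fourier_approx f _ sf f0 eK.
pose S := fourier_sum f N; pose E x := f x - S x.
have mS : measurable_fun setT S by exact: measurable_fourier_sum.
have S1 x : S (x + 1) = S x by exact: fourier_sumD1.
have sS' : sqint S by exact: sqint_fourier_sum.
have mE : measurable_fun setT E by exact: measurable_funB.
have E1 x : E (x + 1) = E x by rewrite /E f1 S1.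
have sE : sqint E by exact: sqintB.
pose Q x := \sum_(p <= k < q) c k * S (k%:R * x).
pose W x := \sum_(p <= k < q) c k * E (k%:R * x).
have BE x : B x = Q x + W x.
  by rewrite /B /Q /W -big_split/=; apply: eq_bigr => k _; rewrite /E; ring.
have WK : ip W W <= K * ip E E.
  rewrite (@eq_ip _ _ (fun x => \sum_(p <= k < q) u E k x) _ (fun x => \sum_(p <= k < q) u E k x));
    [|by move=> x _; exact: uE..].
  apply: (le_trans (ip_sum_le _ (su _ mE E1 sE))).
  rewrite -mulrA ler_wpM2l// mulr_suml big_nat_cond [leRHS]big_nat_cond.
  apply: ler_sum => k; rewrite andbT => kpq; have [sk kE] := dil E mE E1 sE k kpq.
  rewrite /u kpq ipZl ?ipZr//; last exact: sqintZ.
  by rewrite kE mulrA expr2.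
have := ip_sqD _ _ (sS _ mS S1 sS') (sS _ mE E1 sE).
rewrite (@eq_ip _ _ B _ B); [|by move=> x _; rewrite BE..].
move=> /le_trans; apply.
have := @block_fourier_le f c p q N sf f0 p0 qp Q erefl; rewrite -/X => QX.
have KE : K * ip E E <= e / 2.
  apply: (le_trans (ler_wpM2l K0 fN)).
  rewrite mulrA ler_pdivrMr; last by rewrite mulr_gt0//; lra.
  by nra.
rewrite -/Q -/W; lra.
Qed.

End BlockEstimate.

(** * The Rademacher-Menshov argument *)

Section RademacherMenshov.
Context {R : realType}.
Local Set Implicit Arguments.
Local Unset Strict Implicit.
Implicit Types (u : nat -> R) (a m n N : nat) (H : R).

Lemma summable_of_bounded u H : (forall n, 0 <= u n) ->
  (forall n, \sum_(0 <= k < n) u k <= H) -> cvgn (series u).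
Proof.
move=> u0 uH; apply: nondecreasing_is_cvgn.
  by apply/nondecreasing_seqP => n; rewrite !seriesEnat/= big_nat_recr//= lerDl.
by exists H => _ [n _ <-]; rewrite seriesEnat/=.
Qed.

(** The sharper bound [2 - 1 / (k + 1)] on the sum of [k + 1] terms is stable under induction. *)
Lemma sum_inv_sq_le n : \sum_(0 <= k < n) (k.+1%:R ^+ 2)^-1 <= 2 :> R.
Proof.
suff H k : \sum_(0 <= k < k.+1) (k.+1%:R ^+ 2)^-1 <= 2 - k.+1%:R^-1 :> R.
  case: n => [|n]; first by rewrite big_geq.
  by apply: (le_trans (H n)); rewrite gerBl invr_ge0.
elim: k => [|k IH]; first by rewrite big_nat1; lra.
rewrite big_nat_recr//=; apply: (le_trans (lerD IH (lexx _))).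
have k0 : 0 < k.+1%:R :> R by [].
rewrite -[k.+2%:R]natr1; move: (k.+1%:R) k0 => y y0.
have y1 : 0 < y + 1 by lra.
rewrite -subr_ge0.
have -> : 2 - (y + 1)^-1 - (2 - y^-1 + ((y + 1) ^+ 2)^-1) = (y * (y + 1) ^+ 2)^-1.
  by field; rewrite !gt_eqF.
by rewrite invr_ge0 mulr_ge0 ?sqr_ge0// ltW.
Qed.

(* The sum of the squares of the sums of u over the dyadic subintervals of
   [a, a + 2 ^ m[. *)
Fixpoint dyadic_sq u m a : R :=
  if m is m'.+1 then dyadic_sq u m' a + dyadic_sq u m' (a + 2 ^ m')
    + (\sum_(a <= k < a + 2 ^ m) u k) ^+ 2
  else u a ^+ 2.

Lemma dyadic_sq_ge0 u m a : 0 <= dyadic_sq u m a.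
Proof. by elim: m a => [|m IH] a /=; rewrite ?sqr_ge0// !addr_ge0 ?sqr_ge0. Qed.

Lemma dyadic_sq_top u m a : (\sum_(a <= k < a + 2 ^ m) u k) ^+ 2 <= dyadic_sq u m a.
Proof.
case: m => [|m] /=; first by rewrite expn0 addn1 big_nat1.
by rewrite lerDr addr_ge0// dyadic_sq_ge0.
Qed.

(** An initial segment of [[a, a + 2 ^ m[] is a union of dyadic intervals, at most one from each of
    the [m + 1] levels; the factor is the one of Cauchy-Schwarz. *)
Lemma dyadic_sq_max u m a n : (n <= 2 ^ m)%N ->
  (\sum_(a <= k < a + n) u k) ^+ 2 <= m.+1%:R * dyadic_sq u m a.
Proof.
elim: m a n => [|m IH] a n nm.
  case: n nm => [|[|//]] _.
    by rewrite addn0 big_geq// expr0n/= mulr_ge0 ?sqr_ge0.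
  by rewrite addn1 big_nat1 /= -[1%:R]/1 mul1r.
have V1 := dyadic_sq_ge0 u m a; have V2 := dyadic_sq_ge0 u m (a + 2 ^ m).
have T0 := sqr_ge0 (\sum_(a <= k < a + 2 ^ m.+1) u k).
have m0 : 0 < m.+1%:R :> R by [].
rewrite -[m.+2%:R]natr1 [dyadic_sq u m.+1 a]/=.
have [nm'|nm'] := leqP n (2 ^ m).
  have := IH a n nm'; move: m0; move: (m.+1%:R) => y y0; nra.
have [d dE] : exists d, (n = 2 ^ m + d)%N by exists (n - 2 ^ m)%N; rewrite subnKC// ltnW.
have dm : (d <= 2 ^ m)%N by move: nm; rewrite dE expnS mul2n -addnn leq_add2l.
rewrite dE addnA (@big_cat_nat _ _ _ (a + 2 ^ m)%N) ?leq_addr//=.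
have := IH (a + 2 ^ m)%N d dm; have := dyadic_sq_top u m a.
move: (dyadic_sq u m a) V1 (dyadic_sq u m (a + 2 ^ m)) V2 => v1 v10 v2 v20.
move: (\sum_(a <= _ < _) _) (\sum_(a + 2 ^ m <= _ < _) _) => x z.
move: (\sum_(_ <= _ < _) _) T0 m0 => t; move: (m.+1%:R) => y t0 y0 xv zv.
(* Weighting the first half by 1 and the rest by 1 / y keeps the constant
   linear in the depth. *)
have xz : (x + z) ^+ 2 <= (y + 1) * (x ^+ 2 + y^-1 * z ^+ 2).
  rewrite -subr_ge0.
  have -> : (y + 1) * (x ^+ 2 + y^-1 * z ^+ 2) - (x + z) ^+ 2 = y^-1 * (y * x - z) ^+ 2.
    by field; rewrite gt_eqF.
  by rewrite mulr_ge0 ?sqr_ge0// invr_ge0 ltW.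
apply: (le_trans xz); rewrite ler_pM2l; last by lra.
have : y^-1 * z ^+ 2 <= v2 by rewrite mulrC ler_pdivrMr// mulrC.
lra.
Qed.

(** The first term controls partial sums inside the block [[2 ^ m, 2 ^ (m + 1)[]; the second, by its
    weight [m + 1], makes the full block sums absolutely summable. *)
Definition block_weight u m : R := m.+1%:R * dyadic_sq u m (2 ^ m) +
  (m.+1%:R * \sum_(2 ^ m <= k < 2 ^ m.+1) u k) ^+ 2.

Lemma block_weight_ge0 u m : 0 <= block_weight u m.
Proof. by rewrite addr_ge0 ?sqr_ge0// mulr_ge0// dyadic_sq_ge0. Qed.

Lemma sum_dyadic_blocks u n :
  \sum_(0 <= m < n) \sum_(2 ^ m <= k < 2 ^ m.+1) u k = \sum_(1 <= k < 2 ^ n) u k.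
Proof.
elim: n => [|n IH]; first by rewrite !big_geq.
rewrite big_nat_recr//= IH -big_cat_nat ?expn_gt0//.
by rewrite leq_exp2l.
Qed.

Lemma cvg_of_block_weight u H : (forall n, \sum_(0 <= m < n) block_weight u m <= H) ->
  cvgn (fun N => \sum_(1 <= k < N.+1) u k).
Proof.
move=> uH; pose X m := \sum_(2 ^ m <= k < 2 ^ m.+1) u k.
have w0 := @block_weight_ge0 u.
have cw : block_weight u m @[m --> \oo] --> 0.
  by apply: cvg_series_cvg_0; exact: summable_of_bounded uH.
have cX : cvgn (series X).
  apply: normed_cvg; apply: (@summable_of_bounded _ (H + 2)) => [n|n] /=; first exact: normr_ge0.
  apply: le_trans (lerD (uH n) (sum_inv_sq_le n)).
  rewrite -big_split/=; apply: ler_sum => m _.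
  (* With [y = m + 1], [|X| <= (y X)^2 + y^-2], and both sides of this sum are summable. *)
  apply: (@le_trans _ _ ((m.+1%:R * X m) ^+ 2 + (m.+1%:R ^+ 2)^-1)); last first.
    by rewrite lerD2r /block_weight lerDr mulr_ge0// dyadic_sq_ge0.
  have m0 : 0 < m.+1%:R :> R by [].
  move: (m.+1%:R) m0 => y y0.
  have -> : (y * X m) ^+ 2 = y ^+ 2 * `|X m| ^+ 2 by rewrite real_normK ?num_real// exprMn.
  have z0 := normr_ge0 (X m); move: (`|X m|) z0 => z z0.
  rewrite -subr_ge0.
  have -> : y ^+ 2 * z ^+ 2 + (y ^+ 2)^-1 - z = (y * z - y^-1) ^+ 2 + z.
    by field; rewrite gt_eqF.
  by rewrite addr_ge0 ?sqr_ge0.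
apply/cvg_ex; exists (limn (series X)); apply/cvgrPdist_le => e e0.
have e2 : 0 < e / 2 by lra.
have e4 : 0 < (e / 2) ^+ 2 by rewrite exprn_gt0.
have /cvgrPdist_le/(_ _ e2)[M1 _ M1P] := cX.
have /cvgr0Pnorm_le/(_ _ e4)[M2 _ M2P] := cw.
exists (2 ^ maxn M1 M2)%N => // N /= NM.
have N0 : (0 < N)%N by rewrite (leq_trans _ NM)// expn_gt0.
(* Complete blocks up to [2 ^ m] are near the limit of [series X]; the rest is an initial segment of
   block [m], bounded by [dyadic_sq_max]. *)
pose m := trunc_log 2 N.
have mN : (2 ^ m <= N)%N by exact: trunc_logP.
have Nm : (N < 2 ^ m.+1)%N by exact: trunc_log_ltn.
have : (maxn M1 M2 <= m)%N by exact: trunc_log_max.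
rewrite geq_max => /andP[M1m M2m].
have := M1P m M1m; have := M2P m M2m; rewrite /= seriesEnat/=.
rewrite ger0_norm// /X sum_dyadic_blocks => wm Lm.
rewrite (@big_cat_nat _ _ _ (2 ^ m)%N) ?expn_gt0//=; last by rewrite ltnW.
have NE : (N.+1 = 2 ^ m + (N.+1 - 2 ^ m))%N by rewrite subnKC// ltnW.
have dm : (N.+1 - 2 ^ m <= 2 ^ m)%N.
  by rewrite leq_subLR addnn -mul2n -expnS.
have := dyadic_sq_max u (2 ^ m) dm; rewrite -NE => tail.
have tail2 : (\sum_(2 ^ m <= k < N.+1) u k) ^+ 2 <= (e / 2) ^+ 2.
  apply: (le_trans tail); apply: le_trans wm.
  by rewrite /block_weight lerDl sqr_ge0.
have tail3 : `|\sum_(2 ^ m <= k < N.+1) u k| <= e / 2.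
  move: tail2; move: (\sum_(_ <= _ < _) _) (e / 2) e2 => s b b0 sb.
  by rewrite ler_norml; apply/andP; split; nra.
rewrite opprD addrA [leRHS]splitr (le_trans (ler_normB _ _))// lerD//.
Qed.

End RademacherMenshov.

(** * Almost everywhere convergence *)

Section Convergence.
Context {R : realType}.
Local Set Implicit Arguments.
Local Unset Strict Implicit.
Implicit Types (f : R -> R) (c : nat -> R) (u : nat -> R) (a k m n : nat).

Local Notation D := (`[0%R, 1%R[%classic : set R).
Local Notation mu := (@lebesgue_measure R).
Local Notation dil f c x := (fun k : nat => c k * f (k%:R * x)).
Local Notation wt f c := (fun k : nat => c k ^+ 2 * hfun f k).

Lemma sqint_integral_sq (g : R -> R) : sqint g ->
  mu.-integrable D (EFin \o (fun x => g x ^+ 2)) /\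
  Rintegral mu D (fun x => g x ^+ 2) = ip g g.
Proof.
by move=> sg; split; [case: sg|rewrite /ip; apply: eq_Rintegral => x _; rewrite expr2].
Qed.

(** At each of the [m + 1] levels the subintervals partition [[a, a + 2 ^ m[]. The condition
    [2 ^ m <= a] lets [block_le] apply to each of them. *)
Lemma dyadic_sq_integral f c m a : L2T0 f -> (2 ^ m <= a)%N ->
  mu.-integrable D (EFin \o (fun x => dyadic_sq (dil f c x) m a)) /\
  Rintegral mu D (fun x => dyadic_sq (dil f c x) m a) <=
    m.+1%:R * (4 * \sum_(a <= k < a + 2 ^ m) wt f c k).
Proof.
move=> Lf; elim: m a => [|m IH] a ma.
  have [||sS Sle] := @block_le R f c a a.+1 Lf.
  - exact: leq_trans ma.
  - by rewrite ltnS mul2n -addnn leq_addr.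
  have [iS SE] := sqint_integral_sq sS.
  rewrite expn0 addn1 -[1%:R]/1 mul1r -SE in Sle *.
  rewrite (_ : (fun x => _) = fun x => (\sum_(a <= k < a.+1) c k * f (k%:R * x)) ^+ 2) //.
  by apply/funext => x; rewrite big_nat1.
have m1 : (2 ^ m <= a)%N by rewrite (leq_trans _ ma)// leq_exp2l.
have m2 : (2 ^ m <= a + 2 ^ m)%N by rewrite leq_addl.
have [i1 l1] := IH a m1; have [i2 l2] := IH (a + 2 ^ m)%N m2.
have a0 : (0 < a)%N by rewrite (leq_trans _ ma)// expn_gt0.
have am : (a + 2 ^ m.+1 <= (2 * a).+1)%N by rewrite leqW// mul2n -addnn leq_add2l.
have [sS Sle] := @block_le R f c a (a + 2 ^ m.+1) Lf a0 am.
have [iS SE] := sqint_integral_sq sS; rewrite -SE in Sle.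
have i12 := integrable_unitD _ _ i1 i2; split => /=.
  exact: (integrable_unitD _ _ i12 iS).
rewrite RintegralD// RintegralD//.
have -> : \sum_(a <= k < a + 2 ^ m.+1) wt f c k = \sum_(a <= k < a + 2 ^ m) wt f c k +
    \sum_(a + 2 ^ m <= k < a + 2 ^ m + 2 ^ m) wt f c k.
  rewrite -big_cat_nat ?leq_addr//= -addnA addnn -mul2n -expnS//.
rewrite -[m.+2%:R]natr1; move: Sle.
have -> : \sum_(a <= k < a + 2 ^ m.+1) wt f c k = \sum_(a <= k < a + 2 ^ m) wt f c k +
    \sum_(a + 2 ^ m <= k < a + 2 ^ m + 2 ^ m) wt f c k.
  rewrite -big_cat_nat ?leq_addr//= -addnA addnn -mul2n -expnS//.
move: l1 l2; lra.
Qed.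

Lemma block_weight_integral f c m : L2T0 f ->
  mu.-integrable D (EFin \o (fun x => block_weight (dil f c x) m)) /\
  Rintegral mu D (fun x => block_weight (dil f c x) m) <=
    8 * (m.+1%:R ^+ 2 * \sum_(2 ^ m <= k < 2 ^ m.+1) wt f c k).
Proof.
move=> Lf; have [iV Vle] := @dyadic_sq_integral f c m (2 ^ m) Lf (leqnn _).
have [||sS Sle] := @block_le R f c (2 ^ m) (2 ^ m.+1) Lf.
- by rewrite expn_gt0.
- by rewrite expnS leqnSn.
have sZ := sqintZ m.+1%:R _ sS.
have [iS SE] := sqint_integral_sq sZ.
have iV' := integrable_unitZ m.+1%:R _ iV.
split; first exact: (integrable_unitD _ _ iV' iS).
rewrite /block_weight RintegralD// RintegralZl// SE ipZl// ipZr//.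
move: Vle; rewrite addnn -mul2n -expnS => Vle.
have m0 : 0 <= m.+1%:R :> R by [].
have := ler_wpM2l m0 Vle; have := ler_wpM2l (mulr_ge0 m0 m0) Sle.
lra.
Qed.

(** For [m >= 1] and [k >= 2 ^ m], [m + 1 <= 2 m <= 2 ln k / ln 2]. The block [m = 0] consists of
    [k = 1], where the logarithm vanishes, hence the separate term. *)
Lemma dyadic_log_weight f c m : L2T0 f ->
  m.+1%:R ^+ 2 * \sum_(2 ^ m <= k < 2 ^ m.+1) wt f c k <=
  (m == 0)%:R * wt f c 1%N + 4 / ln 2 ^+ 2 *
    \sum_(2 ^ m <= k < 2 ^ m.+1) wt f c k * ln (k%:R : R) ^+ 2.
Proof.
move=> /L2T0_sqint[_ _ sf f0].
have w0 k : (0 < k)%N -> 0 <= wt f c k.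
  by move=> k0; rewrite mulr_ge0 ?sqr_ge0// hfun_ge0.
have l2 : 0 < ln (2 : R) by rewrite ln_gt0// ltr1n.
case: m => [|m].
  rewrite expn0 expn1 !big_nat1 eqxx ln1 expr0n/= !mulr0 addr0 mul1r.
  by rewrite -[1%:R]/1 expr1n mul1r.
rewrite /= mul0r add0r !mulr_sumr big_nat_cond [leRHS]big_nat_cond.
apply: ler_sum => k /andP[/andP[mk _] _].
have k0 : (0 < k)%N by rewrite (leq_trans _ mk)// expn_gt0.
have lk : m.+1%:R * ln (2 : R) <= ln (k%:R : R).
  rewrite mulr_natl -lnXn// ler_ln ?posrE ?exprn_gt0 ?ltr0n//.
  by rewrite -natrX ler_nat.
have mm : m.+2%:R ^+ 2 <= 4 * m.+1%:R ^+ 2 :> R.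
  have m0 : 1 <= m.+1%:R :> R by rewrite ler1n.
  by rewrite -[m.+2%:R]natr1; move: (m.+1%:R) m0 => y y1; nra.
suff key : m.+2%:R ^+ 2 <= 4 / ln 2 ^+ 2 * ln (k%:R : R) ^+ 2 :> R.
  apply: (le_trans (ler_wpM2r (w0 k k0) key)).
  by rewrite -[leLHS]mulrA (mulrC (ln _ ^+ 2)).
rewrite mulrAC ler_pdivlMr ?exprn_gt0//.
apply: (@le_trans _ _ (4 * m.+1%:R ^+ 2 * ln 2 ^+ 2)).
  by rewrite ler_wpM2r// sqr_ge0.
have a0 : 0 <= m.+1%:R * ln (2 : R) by rewrite mulr_ge0// ltW.
rewrite -mulrA ler_pM2l// -exprMn lerXn2r ?nnegrE//.
exact: le_trans lk.
Qed.

Lemma ae_conv_of_log_weight f c : L2T0 f ->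
  (\sum_(1 <= k <oo) (c k ^+ 2 * hfun f k * ln (k%:R : R) ^+ 2)%:E < +oo)%E ->
  ae_conv f c.
Proof.
move=> Lf Hsum; have [_ _ sf f0] := L2T0_sqint Lf.
have w0 k : (0 < k)%N -> 0 <= wt f c k.
  by move=> k0; rewrite mulr_ge0 ?sqr_ge0// hfun_ge0.
pose s k := wt f c k * ln (k%:R : R) ^+ 2.
have s0 k : (0 < k)%N -> 0 <= s k by move=> k0; rewrite mulr_ge0 ?sqr_ge0// w0.
set S := (\sum_(1 <= k <oo) _)%E in Hsum.
have S0 : (0 <= S)%E by apply: nneseries_ge0 => k k0 _; rewrite lee_fin s0.
have Sfin : S \is a fin_num by rewrite ge0_fin_numE.
have sH n : \sum_(1 <= k < n) s k <= fine S.
  rewrite -lee_fin fineK// -sumEFin.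
  by apply: nneseries_lim_ge => k k0 _; rewrite lee_fin s0.
have l2 : 0 < ln (2 : R) by rewrite ln_gt0// ltr1n.
pose H := 8 * (wt f c 1%N + 4 / ln 2 ^+ 2 * fine S).
pose B m x := block_weight (dil f c x) m.
have iB m : mu.-integrable D (EFin \o B m) by have [] := @block_weight_integral f c m Lf.
have B0 m x : 0 <= B m x by exact: block_weight_ge0.
have BH n : \sum_(0 <= m < n) Rintegral mu D (B m) <= H.
  apply: (@le_trans _ _ (\sum_(0 <= m < n) 8 * ((m == 0)%:R * wt f c 1%N +
      4 / ln 2 ^+ 2 * \sum_(2 ^ m <= k < 2 ^ m.+1) s k))).
    apply: ler_sum => m _; have [_ /le_trans] := @block_weight_integral f c m Lf; apply.
    by rewrite ler_pM2l//; exact: dyadic_log_weight.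
  rewrite -mulr_sumr ler_pM2l// big_split/= -mulr_sumr sum_dyadic_blocks.
  apply: lerD.
    rewrite -mulr_suml -[leRHS]mul1r ler_wpM2r ?w0//.
    case: n => [|n]; first by rewrite big_geq.
    by rewrite big_nat_recl//= big1// addr0.
  by rewrite ler_wpM2l// divr_ge0// sqr_ge0.
have mB m : measurable_fun D (EFin \o B m) by have /integrableP[] := iB m.
(* Summing under the integral sign: the series of block weights has a finite integral, hence is
   finite almost everywhere, and at such points [cvg_of_block_weight] applies. *)
have IB : (\int[mu]_(x in D) (\sum_(0 <= m <oo) (B m x)%:E) <= H%:E)%E.
  rewrite integral_nneseries//; last by move=> m x _; rewrite lee_fin.
  apply: lime_le.
    by apply: is_cvg_nneseries => m _ _; apply: integral_ge0 => x _; rewrite lee_fin.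
  apply: nearW => n.
  rewrite (eq_bigr (fun m => (Rintegral mu D (B m))%:E)).
    by rewrite sumEFin lee_fin.
  by move=> m _; rewrite /Rintegral fineK//; exact: (integrable_fin_num _ (iB m)).
have mS : measurable_fun D (fun x => \sum_(0 <= m <oo) (B m x)%:E)%E.
  have B0' m x : D x -> true -> (0 <= (B m x)%:E)%E by rewrite lee_fin.
  exact: (@ge0_emeasurable_sum _ _ R D (fun m x => (B m x)%:E) xpredT B0' (fun m _ => mB m)).
have iS : mu.-integrable D (fun x => \sum_(0 <= m <oo) (B m x)%:E)%E.
  apply/integrableP; split => //.
  apply: le_lt_trans (ltry H); apply: le_trans IB.
  rewrite le_eqVlt; apply/orP; left; apply/eqP; apply: eq_integral => x _.
  by rewrite gee0_abs// nneseries_ge0// => m _ _; rewrite lee_fin.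
have := @integrable_ae _ _ _ mu D (measurable_itv _) _ iS.
rewrite /ae_conv; apply: filterS => x /= xfin Dx.
have {}xfin := xfin Dx.
apply: (@cvg_of_block_weight _ _ (fine (\sum_(0 <= m <oo) (B m x)%:E)%E)) => n.
rewrite -lee_fin fineK// -sumEFin.
by apply: nneseries_lim_ge => m _ _; rewrite lee_fin block_weight_ge0.
Qed.

End Convergence.

(** * Divergence along sparse primes *)

Section Divergence.
Context {R : realType}.
Local Set Implicit Arguments.
Local Unset Strict Implicit.
Implicit Types (c : nat -> R) (k l m n p r : nat).

Local Notation D := (`[0%R, 1%R[%classic : set R).
Local Notation mu := (@lebesgue_measure R).
Local Notation f := (@cs R 1).

Lemma L2T0_cs1 : L2T0 f.
Proof.
split; first by apply: continuous_measurable_fun; exact: continuous_cs.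
split; first by move=> x; rewrite -[in RHS](addrK 1 x) csB cs_at1 sn_at1 mulr1 mulr0 addr0.
split; last by rewrite -/mu Rintegral_cs.
by rewrite (integral_sqE _ (@sqint_cs R 1)) ltry.
Qed.

(** * The arithmetic functions of a single cosine *)

Lemma gfun_cs1 r : (1 < r)%N -> gfun f r = 0.
Proof.
move=> r1; rewrite /gfun (_ : (fun n => _) = fun=> 0) ?lim_cst//.
apply/funext => n; rewrite big1// => k _.
rewrite /asq fcosE fsinE ip_cs_sn ip_cs_cs//.
have -> : (1 == r * k)%N = false by apply/negbTE; rewrite eq_sym muln_eq1 gtn_eqF.
by rewrite mul0r expr0n/= addr0.
Qed.

Lemma Gfun_cs1 r : (0 < r)%N -> Gfun f r = gfun f 1.
Proof.
move=> r0; rewrite /Gfun big_ltn; last by rewrite ltnS muln_gt0.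
rewrite big_nat_cond big1 ?addr0// => k /andP[/andP[k1 _] _]; exact: gfun_cs1.
Qed.

(** The divisors are 1 and [p]. The terms [g(1)], [G(1)] and [G(p)] all equal [g(1)], and
    [g(p) = 0]. *)
Lemma hfun_cs1_prime p : prime p -> hfun f p = 3 * gfun f 1.
Proof.
move=> pp; have p1 := prime_gt1 pp.
rewrite /hfun (perm_big [:: 1%N; p]); last first.
  apply: uniq_perm; first exact: divisors_uniq.
    by rewrite /= inE andbT neq_ltn p1.
  move=> d; rewrite -dvdn_divisors ?prime_gt0// !inE.
  by case/primeP: pp => _ dP; apply/idP/idP => [/dP//|/orP[]/eqP->].
rewrite big_cons big_seq1/= (Gfun_cs1 (ltnSn 0)) (Gfun_cs1 (prime_gt0 pp)) (gfun_cs1 p1).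
by rewrite mulr0; ring.
Qed.

Lemma sum_geometric_half n : \sum_(0 <= m < n) (2 ^+ m)^-1 <= 2 :> R.
Proof.
suff -> : \sum_(0 <= m < n) (2 ^+ m)^-1 = 2 - 2 * (2 ^+ n)^-1 :> R.
  by rewrite gerBl mulr_ge0// invr_ge0 exprn_ge0.
elim: n => [|n IH]; first by rewrite big_geq// expr0 invr1; ring.
by rewrite big_nat_recr//= IH exprS invfM; field; rewrite expf_neq0.
Qed.

(** The condition [m <= p m] sends [p] to infinity and bounds the indices [m] with [p m < n]. *)
Lemma sparse_primes (delta : R) : 0 < delta -> exists p : nat -> nat,
  forall m, [/\ prime (p m), (m <= p m)%N & ln ((p m)%:R : R) `^ (- delta) <= (2 ^+ m)^-1].
Proof.
move=> d0; suff /choice[p pP] : forall m, exists q,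
  [/\ prime q, (m <= q)%N & ln (q%:R : R) `^ (- delta) <= (2 ^+ m)^-1] by exists p.
move=> m.
(* Chosen so that [y ^ delta = 2 ^ m]; a prime above [exp y] has logarithm at least [y]. *)
pose y : R := (2 ^+ m) `^ delta^-1.
have y0 : 0 < y by rewrite powR_gt0// exprn_gt0.
have [q qb pq] := prime_above (maxn m (Num.bound (expR y))).
move: qb; rewrite gtn_max => /andP[mq bq].
exists q; split => //; first exact: ltnW.
have yq : y <= ln (q%:R : R).
  rewrite -[y]expRK ler_ln ?posrE ?expR_gt0 ?ltr0n ?prime_gt0//.
  rewrite (le_trans (ltW (archi_boundP (expR_ge0 y))))// ler_nat ltnW//.
have yd : y `^ delta = 2 ^+ m.
  by rewrite -powRrM mulVf ?gt_eqF// powRr1// exprn_ge0.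
have lq0 : 0 < ln (q%:R : R) by exact: lt_le_trans yq.
rewrite powRN lef_pV2 ?posrE ?exprn_gt0 ?powR_gt0//.
by rewrite -yd ge0_ler_powR ?nnegrE// ltW.
Qed.

Lemma cvg_terms0 (u : nat -> R) : cvgn (fun N => \sum_(1 <= k < N.+1) u k) ->
  u k @[k --> \oo] --> 0.
Proof.
move=> cu; have /cvg_ex[l ul] := cu; have ul' := ul; rewrite -cvg_shiftS in ul'.
have E : (fun n => u n.+1) =
    (fun n => \sum_(1 <= k < n.+2) u k - \sum_(1 <= k < n.+1) u k).
  by apply/funext => n; rewrite [\sum_(1 <= k < n.+2) u k]big_nat_recr//= addrAC subrr add0r.
have ul0 := cvgB ul' ul; rewrite subrr in ul0.
rewrite -cvg_shiftS E; exact: ul0.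
Qed.

Lemma divergent_example (delta : R) : 0 < delta -> exists c,
  (\sum_(1 <= k <oo) (c k ^+ 2 * hfun f k * (ln (k%:R : R)) `^ (- delta))%:E < +oo)%E /\
  ~ ae_conv f c.
Proof.
move=> d0; have [p pP] := sparse_primes d0.
(* As an indicator of the range of [p], [c] counts a repeated value of [p] once. *)
pose c k : R := `[< exists m, p m = k >]%:R.
have cp m : c (p m) = 1 by rewrite /c; case: asboolP => // /(_ (ex_intro _ m erefl)).
exists c; have [_ _ sf f0] := L2T0_sqint L2T0_cs1; split.
  pose t k := c k ^+ 2 * hfun f k * (ln (k%:R : R)) `^ (- delta).
  have t0 k : (0 < k)%N -> 0 <= t k.
    by move=> k0; rewrite mulr_ge0 ?powR_ge0// mulr_ge0 ?sqr_ge0// hfun_ge0.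
  have g0 : 0 <= 3 * gfun f 1 by rewrite mulr_ge0// gfun_ge0.
  apply: (@le_lt_trans _ _ (3 * gfun f 1 * 2)%:E); last exact: ltry.
  apply: lime_le.
    by apply: is_cvg_nneseries => k k0 _; rewrite lee_fin t0.
  apply: nearW => n; rewrite sumEFin lee_fin.
  (* Each [k < n] in the range of [p] is charged to an [m] with [p m = k], and [m <= p m < n]. *)
  apply: (@le_trans _ _ (\sum_(0 <= m < n) 3 * gfun f 1 * (2 ^+ m)^-1)); last first.
    by rewrite -mulr_sumr ler_wpM2l// sum_geometric_half.
  rewrite (bigID (fun k => `[< exists m, p m = k >]))/= [X in _ + X]big1 ?addr0; last first.
    by move=> k nk; rewrite /c (negbTE nk) expr0n/= !mul0r.
  rewrite -big_filter; apply: (@sum_surj_le _ _ _ _ _ p).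
  - by rewrite filter_uniq// iota_uniq.
  - by move=> m; rewrite mulr_ge0// invr_ge0 exprn_ge0.
  move=> k; rewrite mem_filter mem_index_iota => /andP[/asboolP[m pm] /andP[_ kn]].
  have [prp mp le2] := pP m; exists m; split => //.
    by rewrite mem_index_iota (leq_ltn_trans mp)// pm.
  by rewrite -pm cp expr1n mul1r hfun_cs1_prime// ler_wpM2l.
move=> aec.
suff : ip (cs (p n)) (cs (p n)) @[n --> \oo] --> (0 : R).
  (* Every square norm here is 1/2, so none is below 1/4. *)
  have q0 : 0 < 4^-1 :> R by [].
  move=> /cvg0_le/(_ q0)[m].
  rewrite ip_cs_cs; last by have [/prime_gt0] := pP m.
  by rewrite eqxx /=; lra.
have ic : mu.-integrable D (EFin \o (fun=> 1 ^+ 2 : R)).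
  by have [_] := @sqint_cst R 1.
apply: (ip_ae_dominated_cvg0 _ _ _ ic).
- by move=> n; have [] := @sqint_cs R (p n).
- move=> n x _; rewrite -real_normK ?num_real// lerXn2r// ?nnegrE//.
  exact: cos_max.
(* Where the series converges its terms tend to 0, in particular along [p], where [c] is 1. *)
- have [A [mA A0 cA]] := aec; exists A; split => // x /= nF; apply: cA => /= cx.
  apply: nF => /cx/cvg_terms0 ux.
  have -> : (fun n => cs (p n) x) = (fun k => c k * f (k%:R * x)) \o p.
    by apply/funext => n /=; rewrite cp mul1r cs_mul muln1.
  apply: cvg_comp ux; apply/cvgnyPge => N; exists N => // n /= Nn.
  by have [_ /(leq_trans Nn)] := pP n.
Qed.

End Divergence.

Theorem theorem2 (R : realType) :
  (forall (f : R -> R) (c : nat -> R),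
     L2T0 f ->
     (\sum_(1 <= k <oo) ((c k) ^+ 2 * hfun f k * (ln (k%:R : R)) ^+ 2)%:E < +oo)%E ->
     ae_conv f c)
  /\
  (forall delta : R, 0 < delta ->
     exists (f : R -> R) (c : nat -> R),
       L2T0 f /\
       (\sum_(1 <= k <oo) ((c k) ^+ 2 * hfun f k * (ln (k%:R : R)) `^ (- delta))%:E
          < +oo)%E /\
       ~ ae_conv f c).
Proof.
split=> [f c Lf|delta d0]; first exact: ae_conv_of_log_weight.
have [c [cfin cdiv]] := @divergent_example R delta d0.
by exists (cs 1), c; split; [exact: L2T0_cs1|].
Qed.
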